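(* Let $(M,g)$ be a pseudo-Riemannian manifold of dimension 3. The equation of parametrized conformal geodesics $$\nabla_ua=\frac{3g(u,a)}{|u|^2}\,a-\frac{3|a|^2}{2|u|^2}\,u+|u|^2P^\sharp u-2P(u,u)\,u,\qquad u=\dot x,\quad a=\nabla_uu,$$ for non-null curves $x(t)$ in $M$, is not variational: there is no Lagrangian $L=L(x,\dot x,\ddot x,\dots)$ whose Euler--Lagrange system $\frac{\delta L}{\delta x^k}=0$, $k=1,2,3$, is equivalent to this equation.
   Context: $\nabla$ is the Levi-Civita connection of $g$; $|v|^2=g(v,v)$. The Schouten tensor in dimension 3 is $P=\mathrm{Ric}_g-\frac14R_g\,g$, with $R_g$ the scalar curvature, and $P^\sharp$ is defined by $g(P^\sharp v,w)=P(v,w)$. In local coordinates $u^k=\dot x^k$, $a^k=\ddot x^k+\Gamma^k_{ij}\dot x^i\dot x^j$. Lagrangians are autonomous (time-independent) functions of finitely many derivatives of the curve, and $$\frac{\delta L}{\delta x^k}=\frac{\partial L}{\partial x^k}-\frac{d}{dt}\frac{\partial L}{\partial\dot x^k}+\frac{d^2}{dt^2}\frac{\partial L}{\partial\ddot x^k}-\frac{d^3}{dt^3}\frac{\partial L}{\partial\dddot x^k}+\dots,$$ where $\frac{d}{dt}=\dot x^i\partial_{x^i}+\ddot x^i\partial_{\dot x^i}+\dddot x^i\partial_{\ddot x^i}+\dots$ is the total derivative. The notion of variationality is for the differential equation (equivalence of systems of equations), not for a particular differential operator defining it. *)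

(* Defs.v *)
From HB Require Import structures.
From mathcomp Require Import all_boot all_order all_algebra.
From mathcomp Require Import all_classical all_reals all_analysis.
Import Order.TTheory GRing.Theory Num.Theory numFieldNormedType.Exports.
Set Implicit Arguments.
Unset Strict Implicit.
Unset Printing Implicit Defensive.
Local Open Scope classical_set_scope.
Local Open Scope ring_scope.

Section Smooth.
Variables (R : realType) (V W : normedModType R).

Definition iter_derive (l : seq V) (f : V -> W) : V -> W :=
  foldr (fun v h x => 'D_v h x) f l.

(* C^infinity on U; only used for open U, and then the values of f outside U
   are irrelevant. *)
Definition smooth_on (U : set V) (f : V -> W) : Prop :=
  forall l x, U x -> differentiable (iter_derive l f) x.

End Smooth.

Record chart (R : realType) (n : nat) (M : topologicalType) := Chart {
  cdom : set M;
  ccod : set 'rV[R]_n;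
  cmap : M -> 'rV[R]_n;
  cinv : 'rV[R]_n -> M;
  cdom_open : open cdom;
  ccod_open : open ccod;
  cmap_cod : forall p, cdom p -> ccod (cmap p);
  cinv_dom : forall x, ccod x -> cdom (cinv x);
  cmapK : forall p, cdom p -> cinv (cmap p) = p;
  cinvK : forall x, ccod x -> cmap (cinv x) = x;
  cmap_cont : forall p, cdom p -> {for p, continuous cmap};
  cinv_cont : forall x, ccod x -> {for x, continuous cinv} }.

Definition trans_dom (R : realType) n M (c d : @chart R n M) : set 'rV[R]_n :=
  [set x | ccod c x /\ cdom d (cinv c x)].

Definition trans (R : realType) n M (c d : @chart R n M) : 'rV[R]_n -> 'rV[R]_n :=
  cmap d \o cinv c.

(* The atlas need not be maximal. *)
Record manifold (R : realType) (n : nat) := Manifold {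
  pts :> topologicalType;
  pts_hausdorff : hausdorff_space pts;
  pts_second_countable : @second_countable pts;
  cidx : Type;
  charts : cidx -> chart R n pts;
  charts_cover : forall p, exists a, cdom (charts a) p;
  charts_smooth : forall a b,
    smooth_on (trans_dom (charts a) (charts b)) (trans (charts a) (charts b)) }.

(* The Gram matrices of the metric in the charts.  Coordinates are row vectors
   and the Jacobian acts on the right, whence the transformation rule
   G_a = J G_b J^T. *)
Record pseudo_metric (R : realType) n (M : manifold R n) := PseudoMetric {
  gram :> cidx M -> 'rV[R]_n -> 'M[R]_n;
  gram_smooth : forall a i j, smooth_on (ccod (charts a)) (fun x => gram a x i j);
  gram_sym : forall a x, ccod (charts a) x -> (gram a x)^T = gram a x;
  gram_unit : forall a x, ccod (charts a) x -> gram a x \in unitmx;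
  gram_trans : forall a b x, trans_dom (charts a) (charts b) x ->
    let J := jacobian (trans (charts a) (charts b)) x in
    gram a x = J *m gram b (trans (charts a) (charts b) x) *m J^T }.

Section LocalGeometry.
Variables (R : realType) (n : nat) (G : 'rV[R]_n -> 'M[R]_n).

Definition bilin (A : 'M[R]_n) (v w : 'rV[R]_n) : R := (v *m A *m w^T) 0 0.

Definition partial (i : 'I_n) (h : 'rV[R]_n -> R) (x : 'rV[R]_n) : R :=
  'D_(delta_mx 0 i) h x.

(* christoffel k i j = Gamma^k_{ij} *)
Definition christoffel (k i j : 'I_n) (x : 'rV[R]_n) : R :=
  2^-1 * \sum_l invmx (G x) k l *
    (partial i (fun y => G y j l) x + partial j (fun y => G y i l) x
     - partial l (fun y => G y i j) x).

(* Contraction R^i_{jik}; positive on round spheres. *)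
Definition ricci (x : 'rV[R]_n) : 'M[R]_n :=
  \matrix_(j, k)
    (\sum_i (partial i (christoffel i j k) x - partial j (christoffel i i k) x)
     + \sum_i \sum_p (christoffel i i p x * christoffel p j k x
                      - christoffel i j p x * christoffel p i k x)).

Definition scalar_curv (x : 'rV[R]_n) : R :=
  \sum_j \sum_k invmx (G x) j k * ricci x j k.

End LocalGeometry.

Definition schouten (R : realType) (G : 'rV[R]_3 -> 'M[R]_3) (x : 'rV[R]_3)
    : 'M[R]_3 :=
  ricci G x - (scalar_curv G x / 4) *: G x.

Definition sharp (R : realType) n (g P : 'M[R]_n) (v : 'rV[R]_n) : 'rV[R]_n :=
  v *m P *m invmx g.

Lemma bilin_sharp (R : realType) n (g P : 'M[R]_n) (v w : 'rV[R]_n) :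
  g \in unitmx -> bilin g (sharp g P v) w = bilin P v w.
Proof. by move=> gu; rewrite /bilin /sharp mulmxKV. Qed.

Section Jets.
Variables (R : realType) (n : nat).

(* Jets of infinite order: th j is the coordinate vector x^(j). *)
Definition jet := nat -> 'rV[R]_n.

Definition curve_jet (c : R -> 'rV[R]_n) : jet := fun j => derive1n j c 0.

Definition trunc (m : nat) (th : jet) : 'M[R]_(m.+1, n) :=
  \matrix_(j < m.+1, i < n) th j 0 i.

Definition jet_shift (th : jet) (j : nat) (i : 'I_n) (s : R) : jet :=
  fun j' => if j' == j then th j' + s *: delta_mx 0 i else th j'.

(* Partial derivative with respect to the i-th component of x^(j). *)
Definition jpartial (j : nat) (i : 'I_n) (f : jet -> R) (th : jet) : R :=
  derive1 (fun s => f (jet_shift th j i s)) 0.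

(* The sums over [set: nat] are finitely supported, because the functions they
   are applied to depend on finitely many of the x^(j). *)
Definition tderiv (f : jet -> R) (th : jet) : R :=
  \sum_(j \in [set: nat]) \sum_i th j.+1 0 i * jpartial j i f th.

Definition euler_lagrange (L : jet -> R) (k : 'I_n) (th : jet) : R :=
  \sum_(j \in [set: nat]) (-1) ^+ j * iter j tderiv (jpartial j k L) th.

(* Near every jet of D, each F_k is a linear combination of the E_j and their
   total derivatives, with smooth coefficients depending on finitely many
   derivatives. *)
Definition diff_consequence (D : set jet) (E F : 'I_n -> jet -> R) : Prop :=
  forall th, D th ->
  exists (m N : nat) (O : set 'M[R]_(m.+1, n))
         (c : 'I_n -> 'I_N -> 'I_n -> 'M[R]_(m.+1, n) -> R),
    [/\ open O, O (trunc m th), forall k i j, smooth_on O (c k i j) &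
        forall th', D th' -> O (trunc m th') -> forall k,
          F k th' = \sum_(i < N) \sum_j c k i j (trunc m th') * iter i tderiv (E j) th'].

(* Equivalence of the differential equations E = 0 and F = 0 on D: each system
   consists of differential consequences of the other.  If the two systems are
   equivalent they have the same solutions and the same prolongations.  Bare
   equality of solution sets would also identify regular systems with singular
   ones such as x'^2 + y^2 = 0 with x' = y = 0. *)
Definition equivalent_systems (D : set jet) (E F : 'I_n -> jet -> R) : Prop :=
  diff_consequence D E F /\ diff_consequence D F E.

Section AlongCurves.
Variable G : 'rV[R]_n -> 'M[R]_n.

(* Covariant derivative along x(t) of a vector field depending on the jet. *)
Definition nabla_u (X : jet -> 'rV[R]_n) (th : jet) : 'rV[R]_n :=
  \row_k (tderiv (fun th' => X th' 0 k) th
          + \sum_i \sum_j christoffel G k i j (th 0%N) * th 1%N 0 i * X th 0 j).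

Definition velocity (th : jet) : 'rV[R]_n := th 1%N.

Definition acceleration : jet -> 'rV[R]_n := nabla_u velocity.

End AlongCurves.
End Jets.

(* Left-hand side minus right-hand side of the equation, in a chart with Gram
   matrix G. *)
Definition conformal_geodesic (R : realType) (G : 'rV[R]_3 -> 'M[R]_3)
    (k : 'I_3) (th : jet R 3) : R :=
  let g := G (th 0%N) in
  let P := schouten G (th 0%N) in
  let u := velocity th in
  let a := acceleration G th in
  (nabla_u G (acceleration G) th
   - ((3 * bilin g u a / bilin g u u) *: a
      - (3 * bilin g a a / (2 * bilin g u u)) *: u
      + bilin g u u *: sharp g P u
      - (2 * bilin P u u) *: u)) 0 k.

Section Lagrangians.
Variables (R : realType) (n : nat) (M : manifold R n) (g : pseudo_metric M).

Definition nonnull (a : cidx M) (x u : 'rV[R]_n) : Prop :=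
  ccod (charts a) x /\ bilin (g a x) u u != 0.

Definition nonnull_jets (a : cidx M) : set (jet R n) :=
  [set th | nonnull a (th 0%N) (th 1%N)].

(* Lagrangian of order at most lag_ord.+1 on the jets of non-null curves in M
   (the order is kept positive so that the jet determines the velocity).
   lag_fun a is its expression in the chart a; the expressions in two charts
   agree on the jet at t = 0 of every non-null curve through the overlap. *)
Record lagrangian := Lagrangian {
  lag_ord : nat;
  lag_fun : cidx M -> 'M[R]_(lag_ord.+2, n) -> R;
  lag_smooth : forall a,
    smooth_on [set A | nonnull a (row ord0 A) (row (inord 1) A)] (lag_fun a);
  lag_trans : forall a b (c : R -> 'rV[R]_n), smooth_on setT c ->
    trans_dom (charts a) (charts b) (c 0) -> nonnull_jets a (curve_jet c) ->
    lag_fun a (trunc lag_ord.+1 (curve_jet c)) =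
    lag_fun b (trunc lag_ord.+1 (curve_jet (trans (charts a) (charts b) \o c))) }.

Arguments lag_fun : clear implicits.

Definition lag_jet (L : lagrangian) (a : cidx M) (th : jet R n) : R :=
  lag_fun L a (trunc (lag_ord L).+1 th).

(* An equation on non-null curves, given by its coordinate expression F a in
   every chart a, is variational. *)
Definition variational (F : cidx M -> 'I_n -> jet R n -> R) : Prop :=
  exists L : lagrangian, forall a,
    equivalent_systems (nonnull_jets a) (euler_lagrange (lag_jet L a)) (F a).

End Lagrangians.

(* Main.v *)
Require Import Defs.
From HB Require Import structures.
From mathcomp Require Import all_boot all_order all_algebra.
From mathcomp Require Import all_classical all_reals all_analysis.
From mathcomp Require Import ring lra.
Import Order.TTheory GRing.Theory Num.Theory numFieldNormedType.Exports.
Set Implicit Arguments.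
Unset Strict Implicit.
Unset Printing Implicit Defensive.
Local Open Scope classical_set_scope.
Local Open Scope ring_scope.

(** The obstruction is a parity.  In a chart the equation of conformal geodesics
is a system [x'''_k = - r_k (x, x', x'')] of three equations of order three, so
its solutions are determined by nine parameters.  A variational equation with a
finite-dimensional space of solutions carries a symplectic form on that space,
which therefore has even dimension.  In this way [odd_order_not_variational]
excludes every system of [n] equations solved for the derivatives of order
[m.+1] when [m.+1 * n] is odd.

The argument takes place in the linearization along one formal solution.
The total derivative turns functions on jets into formal power series
([taylor]), and variations into linear differential operators over the ring of
formal power series ([linearize]).  The linearization of the given system is a
monic operator [F] of order [m.+1] ([linearize_solved]).  The linearization of
the Euler-Lagrange system of [L] is an operator [E] built from the Hessian of
[L] ([linearize_euler_lagrange]); it is formally self-adjoint because partial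
derivatives commute ([jpartialC], [schwarz]).  If the two systems are
equivalent, then [F = C \o E] and [E = C' \o F] for differential operators [C]
and [C'] ([diff_consequence_linearize]).

The contradiction is then pure differential algebra
([odd_system_not_selfadjoint]).  Green's formula
[<u, E v> - <E u, v> = D (W u v)] defines a skew form [W] that is constant on
the solutions of [F v = 0].  In odd dimension it has a solution [u <> 0] in its
radical ([presymplectic_degenerate]).  Division by the monic [F] shows that
[W u = B \o E] for a differential operator [B] ([diffop_division],
[low_order_vanish]); so [P = <u, .> - D \o B] satisfies [P \o E = 0], and its
adjoint [Q] satisfies [E \o Q = 0], hence [F \o Q = 0].  A monic operator can
be cancelled ([monic_system_cancel]), so [Q = 0] and [P = 0], and [<u, .>] is a
total derivative, which forces [u = 0] ([exact_pairing]). *)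

(** The solution of a recursion that determines each term of a sequence from
the earlier terms.  It provides the formal solutions of the differential
equations below, which are only needed as infinite jets. *)
Lemma causal_fixpoint (T : Type) (t0 : nat -> T) (Phi : (nat -> T) -> nat -> T) :
  (forall f g n, (forall k, (k < n)%N -> f k = g k) -> Phi f n = Phi g n) ->
  exists f, forall n, f n = Phi f n.
Proof.
move=> causal; pose it n := iter n Phi t0.
have stable n : forall p k, (k < n)%N -> it (n + p)%N k = it n k.
  elim: n => // n IH p k kn.
  rewrite addSn /it /=; apply: causal => j jk; apply: IH.
  exact: leq_trans jk _.
exists (fun n => it n.+1 n) => n; rewrite {1}/it /=.
apply: causal => k kn; rewrite -/(it n).
by rewrite -(subnKC kn) stable.
Qed.

(** * Formal power series as a differential ring *)
Section HurwitzSeries.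
Variable R : comNzRingType.

(** The sequence of the derivatives at [0], that is, a Hurwitz series.  In this
encoding the derivation is the shift, and the infinite jet of a curve is the
series of the curve. *)
Definition hseries : Type := nat -> R.

HB.instance Definition _ := gen_eqMixin hseries.
HB.instance Definition _ := gen_choiceMixin hseries.

Implicit Types a b c : hseries.

Definition hzero : hseries := fun=> 0.
Definition hopp a : hseries := fun k => - a k.
Definition hadd a b : hseries := fun k => a k + b k.

Fact haddA : associative hadd.
Proof. by move=> a b c; apply: funext => k; apply: addrA. Qed.
Fact haddC : commutative hadd.
Proof. by move=> a b; apply: funext => k; apply: addrC. Qed.
Fact hadd0 : left_id hzero hadd.
Proof. by move=> a; apply: funext => k; apply: add0r. Qed.
Fact haddN : left_inverse hzero hopp hadd.
Proof. by move=> a; apply: funext => k; apply: addNr. Qed.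

HB.instance Definition _ := GRing.isZmodule.Build hseries haddA haddC hadd0 haddN.

Definition hderiv a : hseries := fun k => a k.+1.

Fact hderiv_additive : {morph hderiv : a b / a - b}.
Proof. by []. Qed.
HB.instance Definition _ :=
  GRing.isZmodMorphism.Build hseries hseries hderiv hderiv_additive.

(** The binomial convolution, presented by the Leibniz rule.  With this form
the ring axioms follow by induction on the index [k]. *)
Fixpoint hmul_rec k a b : R :=
  if k is k'.+1 then hmul_rec k' (hderiv a) b + hmul_rec k' a (hderiv b)
  else a 0%N * b 0%N.
Definition hmul a b : hseries := fun k => hmul_rec k a b.
Definition hconst (x : R) : hseries := fun k => if k is 0%N then x else 0.

Lemma hconst0 : hconst 0 = 0.
Proof. by apply: funext => -[]. Qed.

Lemma hderiv_hmul a b : hderiv (hmul a b) = hmul (hderiv a) b + hmul a (hderiv b).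
Proof. by []. Qed.

Fact hmulC : commutative hmul.
Proof.
move=> a b; apply: funext => k; rewrite /hmul.
by elim: k a b => [|k IH] a b /=; [rewrite mulrC | rewrite addrC; congr (_ + _)].
Qed.

Fact hmulDl : left_distributive hmul +%R.
Proof.
move=> a b c; apply: funext => k; rewrite /hmul.
elim: k a b c => [|k IH] a b c /=; first exact: mulrDl.
have -> : hderiv (a + b) = hderiv a + hderiv b by [].
rewrite !IH; exact: addrACA.
Qed.

Fact hmulDr a b c : hmul a (b + c) = hmul a b + hmul a c.
Proof. by rewrite hmulC hmulDl !(hmulC a). Qed.

Fact hmulA : associative hmul.
Proof.
move=> a b c; apply: funext => k.
elim: k a b c => [|k IH] a b c; first exact: mulrA.
change (hderiv (hmul a (hmul b c)) k = hderiv (hmul (hmul a b) c) k).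
rewrite !hderiv_hmul hmulDl hmulDr.
change (hmul (hderiv a) (hmul b c) k + (hmul a (hmul (hderiv b) c) k
        + hmul a (hmul b (hderiv c)) k)
      = hmul (hmul (hderiv a) b) c k + hmul (hmul a (hderiv b)) c k
        + hmul (hmul a b) (hderiv c) k).
by rewrite !IH addrA.
Qed.

Fact hmul0 a : hmul 0 a = 0.
Proof. by apply: (addrI (hmul 0 a)); rewrite -hmulDl !addr0. Qed.

Fact hderiv_const x : hderiv (hconst x) = 0.
Proof. by []. Qed.

Fact hmul1 : left_id (hconst 1) hmul.
Proof.
move=> a; apply: funext => k; elim: k a => [|k IH] a; first exact: mul1r.
change (hderiv (hmul (hconst 1) a) k = hderiv a k).
rewrite hderiv_hmul hderiv_const hmul0 add0r; exact: IH.
Qed.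

Fact hconst1_neq0 : hconst 1 != 0.
Proof. by apply/eqP => /(congr1 (fun a : hseries => a 0%N)) /eqP; rewrite oner_eq0. Qed.

HB.instance Definition _ := GRing.Zmodule_isComNzRing.Build hseries
  hmulA hmulC hmul1 hmulDl hconst1_neq0.

Lemma hderivM a b : hderiv (a * b) = hderiv a * b + a * hderiv b.
Proof. by []. Qed.

Lemma hderiv0 : hderiv 0 = 0. Proof. by []. Qed.
Lemma hderivD a b : hderiv (a + b) = hderiv a + hderiv b. Proof. by []. Qed.
Lemma hderivN a : hderiv (- a) = - hderiv a. Proof. by []. Qed.
Lemma hderivB a b : hderiv (a - b) = hderiv a - hderiv b. Proof. by []. Qed.
Lemma hderiv_sum (I : Type) (r : seq I) (P : pred I) (F : I -> hseries) :
  hderiv (\sum_(i <- r | P i) F i) = \sum_(i <- r | P i) hderiv (F i).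
Proof. exact: (raddf_sum hderiv). Qed.

Lemma coefhD a b k : (a + b) k = a k + b k. Proof. by []. Qed.
Lemma coefhN a k : (- a) k = - a k. Proof. by []. Qed.
Lemma coef0hM a b : (a * b) 0%N = a 0%N * b 0%N. Proof. by []. Qed.
Lemma coefh_sum (I : Type) (r : seq I) (P : pred I) (F : I -> hseries) k :
  (\sum_(i <- r | P i) F i) k = \sum_(i <- r | P i) F i k.
Proof. by elim/big_rec2: _ => // i x y _ <-. Qed.

Lemma hseriesP a b : a 0%N = b 0%N -> hderiv a = hderiv b -> a = b.
Proof.
move=> e0 ed; apply: funext => -[|k] //.
exact: (congr1 (fun c : hseries => c k) ed).
Qed.

Lemma coefh_iter_hderiv l a k : iter l (@hderiv) a k = a (l + k)%N.
Proof. by elim: l k => // l IH k; rewrite iterS /hderiv IH addnS. Qed.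

Lemma coefh_constM x a k : (hconst x * a) k = x * a k.
Proof.
elim: k a => // k IH a.
change (hderiv (hconst x * a) k = x * hderiv a k).
by rewrite hderivM hderiv_const mul0r add0r IH.
Qed.

Lemma coefhM_causal a b b' k :
  (forall j, (j <= k)%N -> b j = b' j) -> (a * b) k = (a * b') k.
Proof.
elim: k a b b' => [|k IH] a b b' eb.
  by rewrite !coef0hM eb.
change (hderiv (a * b) k = hderiv (a * b') k).
rewrite !hderivM !coefhD; congr (_ + _); apply: IH => j jk; apply: eb => //.
exact: leqW.
Qed.

Lemma hderiv_sign j : hderiv ((-1) ^+ j : hseries) = 0.
Proof.
have D1 : hderiv (1 : hseries) = 0 by [].
by elim: j => // j IH; rewrite exprS mulN1r hderivN /= IH oppr0.
Qed.

Lemma hderiv_eq0 a : a 0%N = 0 -> hderiv a = 0 -> a = 0.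
Proof. by move=> a0 da; apply: hseriesP. Qed.

End HurwitzSeries.

(** * Linear differential operators over the series *)
Section DifferentialOperators.
Variable R : comNzRingType.
Local Notation A := (hseries R).
Local Notation D := (@hderiv R).

(** The generators [x] stand for the coordinates of the argument.  The same
predicate covers operators on vectors ([coord]) and on scalars ([scal]). *)
Inductive diffop (X I : Type) (x : I -> X -> A) : (X -> A) -> Prop :=
| diffop_gen i : diffop x (x i)
| diffop0 : diffop x (fun=> 0)
| diffopD P Q : diffop x P -> diffop x Q -> diffop x (fun v => P v + Q v)
| diffopZ a P : diffop x P -> diffop x (fun v => a * P v)
| diffop_deriv P : diffop x P -> diffop x (fun v => D (P v)).

Section Closure.
Variables (X I : Type) (x : I -> X -> A).

Lemma eq_diffop P Q : P =1 Q -> diffop x P -> diffop x Q.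
Proof. by move=> /funext ->. Qed.

Lemma diffopN P : diffop x P -> diffop x (fun v => - P v).
Proof.
move=> dP; apply: (@eq_diffop (fun v => - 1 * P v)) => [v|]; first by rewrite mulN1r.
exact: diffopZ.
Qed.

Lemma diffop_sum (J : Type) (r : seq J) (p : pred J) (P : J -> X -> A) :
  (forall j, p j -> diffop x (P j)) ->
  diffop x (fun v => \sum_(j <- r | p j) P j v).
Proof.
move=> dP; elim: r => [|j r IH].
  by apply: (@eq_diffop (fun=> 0)) => [v|]; rewrite ?big_nil//; exact: diffop0.
have [pj|npj] := boolP (p j); last first.
  by apply: eq_diffop IH => v; rewrite big_cons (negbTE npj).
apply: (@eq_diffop (fun v => P j v + \sum_(j <- r | p j) P j v)) => [v|].
  by rewrite big_cons pj.
by apply: diffopD => //; exact: dP.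
Qed.

Lemma diffop_iter l P : diffop x P -> diffop x (fun v => iter l D (P v)).
Proof. by move=> dP; elim: l => //= l; exact: diffop_deriv. Qed.
End Closure.

Lemma diffop_comp (X Y I J : Type) (x : I -> X -> A) (y : J -> Y -> A) P
    (Q : X -> Y) :
  diffop y P -> (forall j, diffop x (y j \o Q)) -> diffop x (P \o Q).
Proof.
move=> dP dQ; elim: dP => {P} //.
- exact: diffop0.
- by move=> P P' _ IH _ IH'; apply: (diffopD IH IH').
- by move=> a P _ IH; apply: (diffopZ a IH).
- by move=> P _ IH; apply: (diffop_deriv IH).
Qed.

Definition coord n (k : 'I_n) (v : 'rV[A]_n) : A := v 0 k.

Section Linear.
Variables (n : nat) (P : 'rV[A]_n -> A).
Hypothesis dP : diffop (@coord n) P.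

Lemma diffop_add v w : P (v + w) = P v + P w.
Proof.
elim: dP => [k||S Q _ IHP _ IHQ|a S _ IH|S _ IH].
- by rewrite /coord mxE.
- by rewrite addr0.
- by rewrite IHP IHQ addrACA.
- by rewrite IH mulrDr.
- by rewrite IH hderivD.
Qed.

Lemma diffop_const c v : D c = 0 -> P (c *: v) = c * P v.
Proof.
move=> Dc; elim: dP => [k||S Q _ IHP _ IHQ|a S _ IH|S _ IH].
- by rewrite /coord mxE.
- by rewrite mulr0.
- by rewrite IHP IHQ mulrDr.
- by rewrite IH mulrCA.
- by rewrite IH hderivM Dc mul0r add0r.
Qed.

Lemma diffop_vec0 : P 0 = 0.
Proof. by rewrite -(scale0r 0) diffop_const ?hderiv0 ?mul0r. Qed.

Lemma diffop_const_sum (J : Type) (r : seq J) (c : J -> A) (e : J -> 'rV[A]_n) :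
  (forall j, D (c j) = 0) ->
  P (\sum_(j <- r) c j *: e j) = \sum_(j <- r) c j * P (e j).
Proof.
move=> Dc; elim: r => [|j r IH]; first by rewrite !big_nil diffop_vec0.
by rewrite !big_cons diffop_add diffop_const // IH.
Qed.
End Linear.

(** The normal form [\sum_i p_i D^i] of a scalar operator. *)
Definition dop (p : {poly A}) (f : A) : A := \sum_(i < size p) p`_i * iter i D f.

Lemma dopE N (p : {poly A}) f : (size p <= N)%N ->
  dop p f = \sum_(i < N) p`_i * iter i D f.
Proof.
move=> leN; rewrite /dop.
rewrite (big_ord_widen N (fun i => p`_i * iter i D f)) //.
rewrite big_mkcond; apply: eq_bigr => i _; case: ltnP => // lei.
by rewrite nth_default ?mul0r.
Qed.

Lemma dopD p q f : dop (p + q) f = dop p f + dop q f.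
Proof.
pose N := maxn (size p) (size q).
rewrite !(@dopE N) ?leq_maxl ?leq_maxr ?size_polyD //.
by rewrite -big_split; apply: eq_bigr => i _; rewrite coefD mulrDl.
Qed.

Lemma dopZ a p f : dop (a *: p) f = a * dop p f.
Proof.
rewrite !(@dopE (size p)) ?size_scale_leq // mulr_sumr.
by apply: eq_bigr => i _; rewrite coefZ mulrA.
Qed.

Lemma dop0 f : dop 0 f = 0.
Proof. by rewrite (@dopE 0) ?size_poly0 ?big_ord0. Qed.

Lemma dop_sum (J : Type) (r : seq J) (p : J -> {poly A}) f :
  dop (\sum_(j <- r) p j) f = \sum_(j <- r) dop (p j) f.
Proof.
by elim: r => [|j r IH]; rewrite ?big_nil ?dop0 // !big_cons dopD IH.
Qed.

(** The composition of [D] with the operator of [p]: the formal Leibniz rule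
[D \o a D^i = a' D^i + a D^(i+1)]. *)
Definition dpoly (p : {poly A}) : {poly A} := map_poly D p + p * 'X.


Lemma coef_dpoly (p : {poly A}) i : (dpoly p)`_i = D p`_i + (if i is i'.+1 then p`_i' else 0).
Proof. by rewrite coefD coef_map_id0 // coefMX; case: i. Qed.

Lemma size_dpoly N (p : {poly A}) : (size p <= N)%N -> (size (dpoly p) <= N.+1)%N.
Proof.
move=> /leq_sizeP pN; apply/leq_sizeP => -[|i] // Ni; rewrite coef_dpoly.
by rewrite !pN ?hderiv0 ?addr0 // leqW.
Qed.

Lemma dop_dpoly p f : dop (dpoly p) f = D (dop p f).
Proof.
rewrite (@dopE (size p).+1) ?size_dpoly // hderiv_sum /=.
under eq_bigr do rewrite coef_dpoly mulrDl.
rewrite big_split big_ord_recr /= nth_default // hderiv0 mul0r addr0.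
rewrite [X in _ + X]big_ord_recl mul0r add0r -big_split; apply: eq_bigr => i _.
by rewrite hderivM.
Qed.

Lemma size_iter_dpoly N l (p : {poly A}) : (size p <= N)%N ->
  (size (iter l dpoly p) <= l + N)%N.
Proof. by move=> pN; elim: l => //= l IH; rewrite addSn size_dpoly. Qed.

Lemma dop_iter_dpoly l p f : dop (iter l dpoly p) f = iter l D (dop p f).
Proof. by elim: l => //= l IH; rewrite dop_dpoly IH. Qed.

(** Composition with a power of [D] leaves the top coefficient unchanged. *)
Lemma coef_iter_dpoly d l (p : {poly A}) : (size p <= d.+1)%N -> (iter l dpoly p)`_(l + d) = p`_d.
Proof.
move=> pd; elim: l => //= l IH; rewrite addSn coef_dpoly IH nth_default ?hderiv0 ?add0r//.
by rewrite -addnS size_iter_dpoly.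
Qed.

(** The coefficient of [D^i] is recovered from the value at [t^i / i!], because
the coefficients of lower order are already known to vanish and [D] of higher
order kills this monomial. *)
Lemma dop_inj p : (forall f, dop p f = 0) -> p = 0.
Proof.
move=> p0; apply/polyP => i; rewrite coef0.
elim/ltn_ind: i => i IH; have [ip|] := ltnP i (size p); last exact: nth_default.
have := p0 (fun k => (k == i)%:R); rewrite /dop (bigD1 (Ordinal ip)) //= big1 => [|j ji].
  (* The sequence k |-> (k == i) is t^i / i!, so its i-th derivative is 1. *)
  rewrite addr0 [X in _ * X](_ : _ = 1) ?mulr1 //.
  apply: funext => k; rewrite coefh_iter_hderiv -[RHS]/((hconst 1 : A) k) /hconst.
  by rewrite -{2}[i : nat]addn0 eqn_add2l; case: k.
have [ji'|ij] := ltnP j i; first by rewrite IH ?mul0r.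
rewrite [X in _ * X](_ : _ = 0) ?mulr0 //.
apply: funext => k; rewrite coefh_iter_hderiv.
by rewrite gtn_eqF // (leq_trans _ (leq_addr _ _)) // ltn_neqAle eq_sym ij andbT.
Qed.

Definition scal (_ : unit) (f : A) : A := f.

Lemma diffop_dop P : diffop scal P -> exists p, P =1 dop p.
Proof.
elim=> [[]||S Q _ [p Sp] _ [q Qq]|a S _ [p Sp]|S _ [p Sp]].
- by exists 1 => f; rewrite /dop size_poly1 big_ord1 coef1 mul1r.
- by exists 0 => f; rewrite dop0.
- by exists (p + q) => f; rewrite dopD Sp Qq.
- by exists (a *: p) => f; rewrite dopZ Sp.
- by exists (dpoly p) => f; rewrite dop_dpoly Sp.
Qed.

(** An operator of the form [D \o Y] with [Y <> 0] has positive order, so it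
cannot be the multiplication by a nonzero [z]. *)
Lemma exact_multiplication z Y : diffop scal Y -> (forall f, z * f = D (Y f)) -> z = 0.
Proof.
move=> /diffop_dop[y Yy] zY.
have zy : z%:P = dpoly y.
  apply/eqP; rewrite -subr_eq0; apply/eqP/dop_inj => f.
  have -> : z%:P - dpoly y = z *: 1 + (-1 : A) *: dpoly y by rewrite scaleN1r alg_polyC.
  rewrite dopD !dopZ dop_dpoly -Yy -zY {1}/dop size_poly1 big_ord1 coef1 mul1r.
  by rewrite mulN1r subrr.
have y0 : y = 0.
  apply/eqP; rewrite -size_poly_eq0; case sy : (size y) => [//|d].
  have := congr1 (fun p : {poly A} => p`_d.+1) zy.
  have := @coef_iter_dpoly d 1 y; rewrite /= add1n sy => -> //.
  rewrite coefC /= => /esym lead0.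
  have : lead_coef y == 0 by rewrite lead_coefE sy lead0.
  by rewrite lead_coef_eq0 => /eqP y0; rewrite y0 size_poly0 in sy.
by apply: (can_inj (@polyCK _)); rewrite zy y0 /dpoly map_poly0 mul0r addr0.
Qed.

(** A linear expression in [v] that is a total derivative for every [v] is
zero: this is how an identity modulo total derivatives becomes an equation. *)
Lemma exact_pairing n (z : 'rV[A]_n) Y : diffop (@coord n) Y ->
  (forall v : 'rV[A]_n, \sum_k z 0 k * v 0 k = D (Y v)) -> z = 0.
Proof.
move=> dY zY; apply/rowP => k; rewrite mxE.
apply: (@exact_multiplication _ (Y \o (fun f => \row_i (f * (i == k)%:R)))) => [|f].
  apply: diffop_comp dY _ => i; apply: (@eq_diffop _ _ _ (fun f => (i == k)%:R * scal tt f)).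
    by move=> f; rewrite /= /coord mxE mulrC.
  by apply: diffopZ; exact: diffop_gen.
rewrite /= -zY (bigD1 k) //= mxE eqxx mulr1 big1 ?addr0 // => i ik.
by rewrite mxE (negbTE ik) !mulr0.
Qed.

(** Integration by parts: [Q] is the formal adjoint of [P], and [X] collects
the boundary terms. *)
Lemma diffop_adjoint n P : diffop (@coord n) P ->
  exists (Q : A -> 'rV[A]_n) (X : A -> 'rV[A]_n -> A),
  [/\ forall k, diffop scal (fun f => Q f 0 k), forall f, diffop (@coord n) (X f) &
      forall f w, f * P w = \sum_k Q f 0 k * w 0 k + D (X f w)].
Proof.
elim=> [k||S T _ [Q [X [dQ dX QX]]] _ [Q' [X' [dQ' dX' QX']]]|a S _ [Q [X [dQ dX QX]]]|
  S dS [Q [X [dQ dX QX]]]].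
- exists (fun f => \row_i ((i == k)%:R * f)), (fun _ _ => 0); split.
  + move=> i; apply: (@eq_diffop _ _ _ (fun f => (i == k)%:R * scal tt f)) => [f|].
      by rewrite mxE.
    by apply: diffopZ; exact: diffop_gen.
  + by move=> f; exact: diffop0.
  + move=> f w; rewrite hderiv0 addr0 (bigD1 k) //= mxE eqxx mul1r big1 ?addr0 // => i ik.
    by rewrite mxE (negbTE ik) !mul0r.
- exists (fun=> 0), (fun _ _ => 0); split.
  + move=> k; apply: (@eq_diffop _ _ _ (fun=> 0)) => [f|]; last exact: diffop0.
    by rewrite mxE.
  + by move=> f; exact: diffop0.
  + by move=> f w; rewrite hderiv0 addr0 mulr0 big1 // => k _; rewrite mxE mul0r.
- exists (fun f => Q f + Q' f), (fun f w => X f w + X' f w); split.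
  + move=> k; apply: (@eq_diffop _ _ _ (fun f => Q f 0 k + Q' f 0 k)) => [f|].
      by rewrite mxE.
    exact: (diffopD (dQ k) (dQ' k)).
  + by move=> f; exact: (diffopD (dX f) (dX' f)).
  + move=> f w; rewrite mulrDr QX QX' addrACA -hderivD -big_split; congr (_ + _).
    by apply: eq_bigr => k _; rewrite mxE mulrDl.
- exists (fun f => Q (a * f)), (fun f => X (a * f)); split => //.
  + move=> k; apply: (@diffop_comp _ _ _ _ scal scal (fun f => Q f 0 k) (fun f => a * f) (dQ k)).
    by move=> i; exact: (diffopZ a (diffop_gen scal tt)).
  + by move=> f w; rewrite mulrCA mulrA QX.
- exists (fun f => Q (- D f)), (fun f w => X (- D f) w + f * S w); split => //.
  + move=> k; apply: (@diffop_comp _ _ _ _ scal scal (fun f => Q f 0 k) (fun f => - D f) (dQ k)).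
    by move=> i; exact: (diffopN (diffop_deriv (diffop_gen scal tt))).
  + by move=> f; exact: (diffopD (dX _) (diffopZ f dS)).
  + move=> f w; rewrite hderivD /= addrA -QX hderivM; ring.
Qed.

Section MonicSystem.
Variables (n m : nat) (a : 'I_m -> 'M[A]_n).

(** The linearization of a system solved for the derivatives of order [m]. *)
Definition monic_system (v : 'rV[A]_n) : 'rV[A]_n :=
  \row_k (iter m D (v 0 k) + \sum_l \sum_i a l i k * iter l D (v 0 i)).

Lemma diffop_monic_system k : diffop (@coord n) (fun v => monic_system v 0 k).
Proof.
apply: (@eq_diffop _ _ _
  (fun v => iter m D (coord k v) + \sum_l \sum_i a l i k * iter l D (coord i v))) => [v|].
  by rewrite mxE.
apply: diffopD; first by apply: diffop_iter; exact: diffop_gen.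
apply: diffop_sum => l _; apply: diffop_sum => i _; apply: diffopZ.
by apply: diffop_iter; exact: diffop_gen.
Qed.

(** The leading coefficient of [monic_system] is the identity, so its
composition with an operator [Q] has the same top coefficient as [Q]. *)
Lemma monic_system_cancel (Q : A -> 'rV[A]_n) :
  (forall k, diffop scal (fun f => Q f 0 k)) ->
  (forall f, monic_system (Q f) = 0) -> forall f, Q f = 0.
Proof.
move=> dQ Q0; have /choice[p Qp] := fun k => diffop_dop (dQ k).
pose q k := iter m dpoly (p k) + \sum_l \sum_i a l i k *: iter l dpoly (p i).
have q0 k : q k = 0.
  apply: dop_inj => f; rewrite dopD dop_iter_dpoly dop_sum.
  have /rowP/(_ k) := Q0 f; rewrite !mxE; apply: etrans.
  rewrite Qp; congr (_ + _); apply: eq_bigr => l _; rewrite dop_sum.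
  by apply: eq_bigr => i _; rewrite dopZ dop_iter_dpoly Qp.
suff p0 d : (forall k, (size (p k) <= d)%N) -> forall k, p k = 0.
  move=> f; apply/rowP => k; rewrite mxE Qp (p0 (\max_k size (p k))) ?dop0 //.
  by move=> j; exact: leq_bigmax.
elim: d => [|d IH] pd; first by move=> k; apply/eqP; rewrite -size_poly_leq0.
apply: IH => k; apply/leq_sizeP => j; rewrite leq_eqVlt => /predU1P[<-|dj]; last first.
  by apply: nth_default; exact: leq_trans (pd k) dj.
have := congr1 (fun r : {poly A} => r`_(m + d)) (q0 k).
rewrite coefD coef_iter_dpoly // coef0 coef_sum big1 ?addr0 // => l _.
rewrite coef_sum big1 // => i _; rewrite coefZ nth_default ?mulr0 //.
by rewrite (leq_trans (size_iter_dpoly l (pd i))) // addnS ltn_add2r.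
Qed.

(** With [monic_system_solvable]: the solutions are in bijection with the
[m * n] initial values. *)
Lemma monic_system_uniq (v : 'rV[A]_n) : (forall k t, (t < m)%N -> (v 0 k) t = 0) ->
  monic_system v = 0 -> v = 0.
Proof.
move=> init0 v0; suff vt t : forall k, (v 0 k) t = 0.
  by apply/rowP => k; rewrite mxE; apply: funext => t; exact: vt.
elim/ltn_ind: t => t IH k; have [tm|mt] := ltnP t m; first exact: init0.
have := congr1 (fun w : 'rV[A]_n => w 0 k (t - m)%N) v0.
rewrite !mxE coefhD coefh_iter_hderiv subnKC // coefh_sum big1 ?addr0 // => l _.
rewrite coefh_sum big1 // => i _.
rewrite (@coefhM_causal _ _ _ 0) ?mulr0 // => j jtm.
rewrite coefh_iter_hderiv IH //.
by rewrite (leq_trans (_ : _ < m + j)%N) ?ltn_add2r // -leq_subRL.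
Qed.

Lemma monic_system_solvable (init : nat -> 'I_n -> R) :
  exists2 v : 'rV[A]_n, monic_system v = 0 & forall k t, (t < m)%N -> (v 0 k) t = init t k.
Proof.
pose ser (f : nat -> 'rV[R]_n) k : A := fun t => f t 0 k.
pose Phi f t : 'rV[R]_n := \row_k
  if (t < m)%N then init t k
  else - (\sum_l \sum_i a l i k * iter l D (ser f i)) (t - m)%N.
have causal f g t : (forall j, (j < t)%N -> f j = g j) -> Phi f t = Phi g t.
  move=> fg; apply/rowP => k; rewrite !mxE; case: ltnP => // mt; congr (- _).
  rewrite !coefh_sum; apply: eq_bigr => l _; rewrite !coefh_sum; apply: eq_bigr => i _.
  apply: coefhM_causal => j jtm; rewrite !coefh_iter_hderiv /ser fg //.
  by rewrite (leq_trans (_ : _ < m + j)%N) ?ltn_add2r // -leq_subRL.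
have [f fE] := causal_fixpoint (fun=> 0) causal.
have vE k : (\row_i ser f i) 0 k = ser f k by rewrite mxE.
exists (\row_k ser f k) => [|k t tm]; last by rewrite vE /ser fE mxE tm.
apply/rowP => k; rewrite !mxE; apply: funext => t.
under eq_bigr do under eq_bigr do rewrite vE.
rewrite coefhD coefh_iter_hderiv {1}/ser fE mxE ltnNge leq_addr /= addKn.
exact: addNr.
Qed.

End MonicSystem.
End DifferentialOperators.

(** * Self-adjoint systems and their presymplectic form *)
Section SelfAdjointSystem.
Variable R : comNzRingType.
Local Notation A := (hseries R).
Local Notation D := (@hderiv R).

(** The boundary terms in [j] integrations by parts. *)
Fixpoint concomitant j (u w : A) : A :=
  if j is j'.+1 then concomitant j' (D u) w + u * ((-1) ^+ j' * iter j' D w) else 0.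

Lemma mulr_iter_parts j u w :
  u * ((-1) ^+ j * iter j D w) = iter j D u * w - D (concomitant j u w).
Proof.
elim: j u => [|j IH] u; first by rewrite expr0 mul1r /= hderiv0 subr0.
have -> : concomitant j.+1 u w = concomitant j (D u) w + u * ((-1) ^+ j * iter j D w) by [].
have := IH (D u); rewrite hderivD /= hderivM hderivM hderiv_sign -iterSr iterS exprS => IH'.
by ring: IH'.
Qed.

Section Closure.
Variables (X I : Type) (x : I -> X -> A).

Lemma diffop_concomitantl j w P : diffop x P -> diffop x (fun v => concomitant j (P v) w).
Proof.
elim: j P => [|j IH] P dP /=; first exact: diffop0.
apply: diffopD; first exact: (IH (fun v => D (P v)) (diffop_deriv dP)).
apply: (@eq_diffop _ _ _ _ (fun v => (-1) ^+ j * iter j D w * P v)); last exact: diffopZ.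
by move=> v; rewrite mulrC.
Qed.

Lemma diffop_concomitantr j u P : diffop x P -> diffop x (fun v => concomitant j u (P v)).
Proof.
move=> dP; elim: j u => [|j IH] u /=; first exact: diffop0.
by apply: diffopD; [exact: IH | do 2!apply: diffopZ; exact: diffop_iter].
Qed.
End Closure.

Variables (n N : nat) (H : 'I_N * 'I_n -> 'I_N * 'I_n -> A).
Hypothesis H_sym : forall p q, H p q = H q p.

(** [H] is the Hessian of a Lagrangian with respect to the jet coordinates
along a curve; the coordinates are indexed by an order of derivation and a
component. *)
Definition vjet (p : 'I_N * 'I_n) (v : 'rV[A]_n) : A := iter p.1 D (v 0 p.2).

Lemma diffop_vjet p : diffop (@coord R n) (vjet p).
Proof. by apply: diffop_iter; exact: (diffop_gen (@coord R n) p.2). Qed.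

(** The linearized Euler-Lagrange operator.  It is formally self-adjoint
because the Hessian is symmetric, see [hessian_system_green]. *)
Definition hessian_system (v : 'rV[A]_n) : 'rV[A]_n :=
  \row_k \sum_(j < N) (-1) ^+ j * iter j D (\sum_q H (j, k) q * vjet q v).

Definition boundary (u v : 'rV[A]_n) : A :=
  \sum_(p : 'I_N * 'I_n) concomitant p.1 (u 0 p.2) (\sum_q H p q * vjet q v).

Lemma diffop_boundaryl v : diffop (@coord R n) (boundary^~ v).
Proof.
by apply: diffop_sum => p _; apply: diffop_concomitantl; exact: (diffop_gen (@coord R n) p.2).
Qed.

Lemma diffop_boundaryr u : diffop (@coord R n) (boundary u).
Proof.
apply: diffop_sum => p _; apply: diffop_concomitantr; apply: diffop_sum => q _.
by apply: diffopZ; exact: diffop_vjet.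
Qed.

(** On two solutions the derivative of this form vanishes, by
[hessian_system_green]: it is the conserved presymplectic form of the
variational problem. *)
Definition presymplectic (u v : 'rV[A]_n) : A := boundary v u - boundary u v.

Lemma diffop_presymplectic u : diffop (@coord R n) (presymplectic u).
Proof. exact: (diffopD (diffop_boundaryl u) (diffopN (diffop_boundaryr u))). Qed.

Lemma presymplectic_skew u v : presymplectic u v = - presymplectic v u.
Proof. by rewrite opprB. Qed.

Lemma hessian_system_parts (u v : 'rV[A]_n) : \sum_k u 0 k * hessian_system v 0 k =
  \sum_p \sum_q vjet p u * H p q * vjet q v - D (boundary u v).
Proof.
rewrite hderiv_sum -sumrB /=.
transitivity (\sum_k \sum_(j < N) (vjet (j, k) u * (\sum_q H (j, k) q * vjet q v)
   - D (concomitant j (u 0 k) (\sum_q H (j, k) q * vjet q v)))).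
  apply: eq_bigr => k _; rewrite mxE mulr_sumr; apply: eq_bigr => j _.
  exact: mulr_iter_parts.
rewrite exchange_big pair_bigA; apply: eq_bigr => -[j k] _ /=; congr (_ - _).
by rewrite mulr_sumr; apply: eq_bigr => q _; rewrite mulrA.
Qed.

Lemma hessian_system_green (u v : 'rV[A]_n) :
  \sum_k u 0 k * hessian_system v 0 k - \sum_k hessian_system u 0 k * v 0 k
  = D (presymplectic u v).
Proof.
rewrite [X in _ - X](_ : _ = \sum_k v 0 k * hessian_system u 0 k); last first.
  by apply: eq_bigr => k _; rewrite mulrC.
rewrite !hessian_system_parts hderivB /=.
rewrite [X in _ - (X - _)](_ : _ = \sum_p \sum_q vjet p u * H p q * vjet q v).
  by ring.
rewrite exchange_big; apply: eq_bigr => p _; apply: eq_bigr => q _.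
by rewrite H_sym; ring.
Qed.

Lemma diffop_hessian_system k : diffop (@coord R n) (fun v => hessian_system v 0 k).
Proof.
apply: (@eq_diffop _ _ _ _ (fun v =>
  \sum_(j < N) (-1) ^+ j * iter j D (\sum_q H (j, k) q * vjet q v))) => [v|].
  by rewrite mxE.
apply: diffop_sum => j _; apply: diffopZ; apply: diffop_iter; apply: diffop_sum => q _.
by apply: diffopZ; exact: diffop_vjet.
Qed.

End SelfAdjointSystem.

(** * A self-adjoint system has no odd-dimensional solution space *)
Section OddSystem.
Variable R : numFieldType.
Local Notation A := (hseries R).
Local Notation D := (@hderiv R).
Variables (n m : nat) (a : 'I_m.+1 -> 'M[A]_n).
Local Notation F := (monic_system a).

Section Division.
Implicit Types b : nat -> 'I_n -> A.

(** The normal form of an operator modulo the left ideal generated by the monic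
system [F]: only the derivatives of order at most [m] remain. *)
Definition low_order b (v : 'rV[A]_n) : A :=
  \sum_(l < m.+1) \sum_i b l i * iter l D (v 0 i).

(** The contribution of the shift [D^l v |-> D^(l+1) v] to the derivative of
[low_order b]; the derivative of order [m.+1] is eliminated by means of [F]. *)
Definition low_order_step b l k : A :=
  (if l is l'.+1 then b l' k else 0) - \sum_i b m i * a (inord l) k i.

Lemma low_orderD b b' v : low_order b v + low_order b' v =
  low_order (fun l i => b l i + b' l i) v.
Proof.
rewrite -big_split; apply: eq_bigr => l _; rewrite -big_split; apply: eq_bigr => i _.
by rewrite mulrDl.
Qed.

Lemma low_orderZ c b v : c * low_order b v = low_order (fun l i => c * b l i) v.
Proof.
rewrite mulr_sumr; apply: eq_bigr => l _; rewrite mulr_sumr; apply: eq_bigr => i _.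
by rewrite mulrA.
Qed.

Lemma low_order_deriv b v : D (low_order b v) =
  low_order (fun l i => D (b l i) + low_order_step b l i) v + \sum_i b m i * F v 0 i.
Proof.
rewrite -low_orderD -addrA hderiv_sum /=.
under eq_bigr do rewrite hderiv_sum /=; under eq_bigr do under eq_bigr do rewrite hderivM.
under eq_bigr do rewrite big_split /=; rewrite big_split /=; congr (_ + _).
rewrite big_ord_recr /=; under [X in _ = _ + X]eq_bigr do rewrite mxE mulrDr.
rewrite big_split /= addrCA addrC; congr (_ + _).
rewrite /low_order; under [X in _ = X + _]eq_bigr do under eq_bigr do rewrite mulrBl.
under [X in _ = X + _]eq_bigr do rewrite sumrB.
rewrite sumrB -addrA -[LHS]addr0; congr (_ + _).
  by rewrite [RHS]big_ord_recl [X in X + _]big1 ?add0r // => i _; exact: mul0r.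
apply/esym/eqP; rewrite addrC subr_eq0; apply/eqP.
under eq_bigr do rewrite mulr_sumr; rewrite exchange_big; apply: eq_bigr => l _ /=.
under eq_bigr do rewrite mulr_sumr; rewrite exchange_big; apply: eq_bigr => i _ /=.
by rewrite mulr_suml; apply: eq_bigr => k _; rewrite inord_val mulrA.
Qed.

(** The initial values of solutions are arbitrary, so the coefficients vanish
at [t = 0].  The derivative of [low_order b] is again such an expression modulo
[F] and also vanishes on solutions; this passes the vanishing on to the Taylor
coefficients of higher order. *)
Lemma low_order_vanish b : (forall v, F v = 0 -> low_order b v = 0) ->
  forall v, low_order b v = 0.
Proof.
move=> b0; suff bt t : forall l k, (l <= m)%N -> b l k t = 0.
  move=> v; rewrite /low_order big1 // => l _; rewrite big1 // => i _.
  rewrite [b l i](_ : _ = 0) ?mul0r //; apply: funext => t; apply: bt.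
  exact: (ltn_ord l).
suff: forall s, (s <= t)%N -> forall l k, (l <= m)%N -> b l k s = 0 by exact.
elim: t b b0 => [|t IH] b b0 s st l k lm.
  move: st; rewrite leqn0 => /eqP ->.
  have [v Fv vinit] := monic_system_solvable a (fun t i => ((t == l) && (i == k))%:R).
  have := congr1 (fun c : A => c 0%N) (b0 v Fv).
  rewrite /low_order coefh_sum (bigD1 (Ordinal (lm : l < m.+1)%N)) //= coefh_sum (bigD1 k) //=.
  rewrite coef0hM coefh_iter_hderiv addn0 vinit // !eqxx mulr1 big1 => [|i ik].
    rewrite addr0 big1 ?addr0 // => j jl; rewrite coefh_sum big1 // => i _.
    rewrite coef0hM coefh_iter_hderiv addn0 vinit ?ltn_ord //.
    by rewrite (_ : (j == l :> nat) = false) ?mulr0 //; apply: contraNF jl.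
  by rewrite coef0hM coefh_iter_hderiv addn0 vinit // (negbTE ik) andbF mulr0.
have bt := IH b b0.
move: st; rewrite leq_eqVlt => /predU1P[->|]; last by move=> st; exact: bt.
pose b' l i := D (b l i) + low_order_step b l i.
have b'0 v : F v = 0 -> low_order b' v = 0.
  move=> Fv; have := low_order_deriv b v; rewrite b0 // hderiv0 Fv.
  by under eq_bigr do rewrite mxE mulr0; rewrite big1_eq addr0 => /esym.
have step0 : low_order_step b l k t = 0.
  rewrite /low_order_step coefhD coefhN coefh_sum big1 => [|i _]; last first.
    rewrite mulrC (@coefhM_causal _ _ _ 0) ?mulr0 // => j jt; exact: bt.
  by rewrite subr0; case: l lm => // l lm; apply: bt => //; exact: ltnW.
by have := IH b' b'0 t (leqnn t) l k lm; rewrite /b' coefhD step0 addr0.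
Qed.

Lemma diffop_division P : diffop (@coord R n) P ->
  exists B b, diffop (@coord R n) B /\ forall v, P v = B (F v) + low_order b v.
Proof.
elim=> [k||S T _ [B [b [dB SB]]] _ [B' [b' [dB' TB]]]|c S _ [B [b [dB SB]]]|
  S dS [B [b [dB SB]]]].
- exists (fun=> 0), (fun l i => ((l == 0%N) && (i == k))%:R); split; first exact: diffop0.
  move=> v; rewrite add0r /low_order big_ord_recl (bigD1 k) //= eqxx mul1r.
  rewrite big1 => [|i /negbTE ->]; last by rewrite mul0r.
  rewrite addr0 big1 ?addr0 // => l _; rewrite big1 // => i _; exact: mul0r.
- exists (fun=> 0), (fun _ _ => 0); split; first exact: diffop0.
  move=> v; rewrite add0r /low_order big1 // => l _; rewrite big1 // => i _; exact: mul0r.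
- exists (fun v => B v + B' v), (fun l i => b l i + b' l i); split; first exact: diffopD.
  by move=> v; rewrite SB TB -low_orderD addrACA.
- exists (fun v => c * B v), (fun l i => c * b l i); split; first exact: diffopZ.
  by move=> v; rewrite SB mulrDr low_orderZ.
- exists (fun v => D (B v) + \sum_i b m i * v 0 i), (fun l i => D (b l i) + low_order_step b l i).
  split; last by move=> v; rewrite SB hderivD /= low_order_deriv addrA addrAC.
  apply: diffopD; first exact: diffop_deriv.
  by apply: diffop_sum => i _; apply: diffopZ; exact: (diffop_gen (@coord R n) i).
Qed.
End Division.

Variables (N : nat) (H : 'I_N * 'I_n -> 'I_N * 'I_n -> A).
Local Notation E := (hessian_system H).
Local Notation W := (presymplectic H).
Hypothesis H_sym : forall p q, H p q = H q p.

(** The presymplectic form is a skew form on the space of solutions, whose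
dimension [m.+1 * n] is odd; so its matrix is singular. *)
Lemma presymplectic_degenerate : odd (m.+1 * n) -> (forall v, F v = 0 -> E v = 0) ->
  exists u, [/\ u != 0, F u = 0 & forall v, F v = 0 -> W u v = 0].
Proof.
move=> odd_mn FE.
have /choice[e eP] : forall p : 'I_m.+1 * 'I_n, exists v : 'rV[A]_n, F v = 0 /\
    forall k t, (t < m.+1)%N -> (v 0 k) t = ((t == p.1) && (k == p.2))%:R.
  move=> p; have [v] := monic_system_solvable a (fun t k => ((t == p.1) && (k == p.2))%:R).
  by move=> *; exists v.
(* Constant combinations of the solutions e p, which form a basis. *)
pose comb (c : 'I_m.+1 * 'I_n -> R) : 'rV[A]_n := \sum_p hconst (c p) *: e p.
have Dc (c : 'I_m.+1 * 'I_n -> R) p : D (hconst (c p)) = 0 by [].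
have Fcomb c : F (comb c) = 0.
  apply/rowP => k; rewrite (diffop_const_sum (diffop_monic_system a k)) // mxE.
  by rewrite big1 // => p _; rewrite (eP p).1 mxE mulr0.
have comb_init c k (t : 'I_m.+1) : (comb c 0 k) t = c (t, k).
  rewrite summxE coefh_sum (bigD1 (t, k)) //= big1 => [|p ptk].
    by rewrite mxE coefh_constM addr0 (eP _).2 // !eqxx mulr1.
  rewrite mxE coefh_constM (eP _).2 // (_ : _ && _ = false) ?mulr0 //.
  by apply: contraNF ptk => /andP[/eqP/val_inj tp /eqP kp]; case: p tp kp => ? ? /= -> ->.
have combE v : F v = 0 -> v = comb (fun p => (v 0 p.2) p.1).
  move=> Fv; apply/eqP; rewrite -subr_eq0; apply/eqP; apply: (@monic_system_uniq _ _ _ a).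
    move=> k t tm; rewrite !mxE coefhD coefhN.
    by rewrite (comb_init _ _ (Ordinal tm)) subrr.
  apply/rowP => k; rewrite -scaleN1r (diffop_add (diffop_monic_system a k)).
  rewrite (diffop_const (diffop_monic_system a k)); last first.
    exact: (hderiv_sign R 1).
  by rewrite Fv Fcomb !mxE mulr0 addr0.
pose d := #|{: 'I_m.+1 * 'I_n}|.
pose Om : 'M[R]_d := \matrix_(i, j) (W (e (enum_val i)) (e (enum_val j))) 0%N.
have OmT : Om^T = (-1) *: Om.
  by apply/matrixP => i j; rewrite !mxE presymplectic_skew mulN1r.
have /det0P[x x0 xOm] : \det Om == 0.
  have : \det Om = - \det Om.
    have odd_d : odd d by rewrite /d card_prod !card_ord.
    by rewrite -{1}det_tr OmT detZ -signr_odd odd_d expr1 mulN1r.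
  by move/eqP; rewrite -addr_eq0 -mulr2n mulrn_eq0.
pose c p := x 0 (enum_rank p); exists (comb c); split => //.
  apply: contraNneq x0 => c0; apply/eqP/rowP => i; rewrite mxE.
  have := comb_init c (enum_val i).2 (enum_val i).1.
  by rewrite c0 mxE -surjective_pairing /c enum_valK => <-.
move=> v Fv; apply: hderiv_eq0; last first.
  rewrite -hessian_system_green // !FE //.
  by rewrite !big1 ?subr0 // => k _; rewrite mxE ?mulr0 ?mul0r.
rewrite (combE v Fv) /comb (diffop_const_sum (diffop_presymplectic H _)) // coefh_sum.
rewrite big1 // => q _; rewrite coef0hM presymplectic_skew.
rewrite (diffop_const_sum (diffop_presymplectic H _)) // coefhN coefh_sum.
suff -> : \sum_p (hconst (c p) * W (e q) (e p)) 0%N = - (x *m Om) 0 (enum_rank q).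
  by rewrite xOm mxE !oppr0 mulr0.
rewrite mxE -sumrN (reindex_onto enum_val enum_rank) => [|p _]; last exact: enum_rankK.
apply: eq_big => [i|i _]; first by rewrite enum_valK eqxx.
by rewrite coef0hM presymplectic_skew coefhN mxE /c enum_valK enum_rankK mulrN.
Qed.

(** The presymplectic form is also nondegenerate.  Let [u] be in its radical.
Then [W u] vanishes on the solutions, so [W u = B \o E] for an operator [B],
and Green's formula makes [P = <u, .> - D \o B] annihilate the image of [E].
As [E] is self-adjoint, it annihilates the image of the adjoint [Q] of [P], and
so does the monic [F]; hence [Q = 0].  But the pairings with [Q 1] and with [u]
differ by a total derivative, so [u = Q 1]. *)
Theorem odd_system_not_selfadjoint : odd (m.+1 * n) -> (forall v, F v = 0 -> E v = 0) ->
  (forall k, exists2 B, diffop (@coord R n) B & forall v, F v 0 k = B (E v)) -> False.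
Proof.
move=> odd_mn FE EF; have [u [/eqP u0 Fu Wu]] := presymplectic_degenerate odd_mn FE.
apply: u0; have EF0 v : E v = 0 -> F v = 0.
  move=> Ev; apply/rowP => k; have [B dB ->] := EF k.
  by rewrite Ev (diffop_vec0 dB) mxE.
have [B dB WB] : exists2 B, diffop (@coord R n) B & forall v, W u v = B (E v).
  have [B0 [b [dB0 Wb]]] := diffop_division (diffop_presymplectic H u).
  have b0 : forall v, low_order b v = 0.
    apply: low_order_vanish => v Fv; have := Wb v.
    by rewrite Wu // Fv (diffop_vec0 dB0) add0r.
  have /choice[C CP] : forall k, exists B, diffop (@coord R n) B /\ forall v, F v 0 k = B (E v).
    by move=> k; have [B dB FB] := EF k; exists B.
  exists (B0 \o (fun v => \row_k C k v)).
    apply: diffop_comp dB0 _ => k; apply: (eq_diffop _ (CP k).1) => v.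
    by rewrite /= /coord mxE.
  move=> v; rewrite Wb b0 addr0 /=; congr B0; apply/rowP => k.
  by rewrite mxE (CP k).2.
pose P v := \sum_k u 0 k * coord k v - D (B v).
have dP : diffop (@coord R n) P.
  apply: diffopD; last by apply: diffopN; exact: diffop_deriv.
  by apply: diffop_sum => k _; apply: diffopZ; exact: diffop_gen.
have PE v : P (E v) = 0.
  apply/eqP; rewrite subr_eq0 -WB -hessian_system_green // (FE u Fu); apply/eqP.
  by rewrite [X in _ - X]big1 ?subr0 // => k _; rewrite mxE mul0r.
have [Q [X [dQ dX QX]]] := diffop_adjoint dP.
have EQ f : E (Q f) = 0.
  apply: (@exact_pairing _ _ _ (fun v => - (X f (E v) + W (Q f) v))) => [|v].
    apply: diffopN; apply: diffopD; last exact: diffop_presymplectic.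
    by apply: (diffop_comp (dX f)) => k; exact: diffop_hessian_system.
  have := QX f (E v); rewrite PE mulr0 hderivN hderivD /= -hessian_system_green // => /esym/eqP.
  by rewrite addr_eq0 => /eqP ->; ring.
have Q0 := monic_system_cancel dQ (fun f => EF0 _ (EQ f)).
apply: (@exact_pairing _ _ _ (fun v => B v + X 1 v)) => [|v]; first exact: diffopD.
have := QX 1 v; rewrite mul1r Q0 big1 ?add0r => [|k _]; last by rewrite mxE mul0r.
by rewrite hderivD /= => <-; rewrite addrC subrK.
Qed.

End OddSystem.

(** * Symmetry of second derivatives *)
Lemma derive_line (R : realType) (V W : normedModType R) (F : V -> W) x d :
  'D_d F x = 'D_1 (fun s : R => F (x + s *: d)) 0.
Proof.
rewrite /derive; apply: (congr1 (fun f : R -> W => lim (f @ 0^'))); apply: funext => h /=.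
rewrite addr0 scale0r addr0 [x + _]addrC; by rewrite [h *: 1]mulr1.
Qed.

Lemma derivable_line (R : realType) (V W : normedModType R) (F : V -> W) x d s :
  derivable F (x + s *: d) d -> derivable (fun s : R => F (x + s *: d)) s 1.
Proof.
rewrite /derivable; set f := (X in cvg (X @ _)) => Fd.
rewrite [X in cvg (X @ _)](_ : _ = f) //; apply: funext => h; rewrite /f /=.
by rewrite scaler1 scalerDl addrCA.
Qed.

Lemma derive_line_at (R : realType) (V W : normedModType R) (F : V -> W) x d s :
  'D_1 (fun s : R => F (x + s *: d)) s = 'D_d F (x + s *: d).
Proof.
rewrite /derive; apply: (congr1 (fun f : R -> W => lim (f @ 0^'))); apply: funext => h /=.
by rewrite scaler1 scalerDl addrCA.
Qed.

Section Schwarz.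
Variables (R : realType) (V : normedModType R) (F : V -> R) (O : set V) (x : V).
Hypotheses (oO : open O) (Ox : O x) (dF : forall y, O y -> differentiable F y).

Definition second_difference (v w : V) (t : R) : R :=
  F (x + t *: v + t *: w) - F (x + t *: v) - F (x + t *: w) + F x.

Lemma near0_line (P : V -> Prop) (v w : V) : (\forall y \near (0 : V), P y) ->
  \forall t \near (0:R)^'+, forall s, 0 <= s <= t -> P (s *: v + t *: w) /\ P (s *: v).
Proof.
move=> /nbhs_ballP[e /= e0 eP].
have M0 : 0 < `|v| + `|w| + 1 by rewrite ltr_wpDl // addr_ge0.
near=> t => s /andP[s0 st].
have t0 : 0 <= t by exact: le_trans st.
have tM : t * (`|v| + `|w| + 1) < e.
  by rewrite -ltr_pdivlMr //; near: t; apply: nbhs_right_lt; rewrite divr_gt0.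
have sv : s * `|v| <= t * `|v| by exact: ler_wpM2r.
have tw : 0 <= t * `|w| by exact: mulr_ge0.
have tpos : 0 < t by near: t; exact: nbhs_right_gt.
split; apply: eP; rewrite -ball_normE /= sub0r normrN.
  apply: le_lt_trans (ler_normD _ _) _; rewrite !normrZ !ger0_norm //; nra.
rewrite normrZ ger0_norm //; nra.
Unshelve. all: by end_near.
Qed.

(** By the mean value theorem in the direction [v], the second difference is
[t] times the increment by [t *: w] of the derivative along [v], and this
increment is controlled by the differential at [x]. *)
Lemma second_difference_approx v w e : 0 < e -> differentiable ('D_v F) x ->
  \forall t \near (0:R)^'+,
    `|second_difference v w t - t ^+ 2 * 'D_w ('D_v F) x| <= e * t ^+ 2.
Proof.
move=> e0 dDF; rewrite (deriveE w dDF).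
set L := 'd ('D_v F) x.
pose M := 2 * `|v| + `|w| + 1.
have M0 : 0 < M by rewrite /M ltr_wpDl // addr_ge0 // mulr_ge0.
have approx : \forall y \near (0 : V), `|'D_v F (y + x) - ('D_v F x + L y)| <= e / M * `|y|.
  have [_ /eqaddoP] := (diff_locallyP _ _).1 dDF.
  by move=> /(_ (e / M) (divr_gt0 e0 M0)); apply: filterS => y.
have inO : \forall y \near (0 : V), O (y + x).
  have : \forall y \near x, O y by exact: open_nbhs_nbhs.
  by rewrite (near_shift 0); apply: filterS => y /=; rewrite subr0.
near=> t.
have t0 : 0 < t by near: t; exact: nbhs_right_gt.
have A : forall s, 0 <= s <= t ->
    `|'D_v F (s *: v + t *: w + x) - ('D_v F x + L (s *: v + t *: w))| <=
      e / M * `|s *: v + t *: w| /\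
    `|'D_v F (s *: v + x) - ('D_v F x + L (s *: v))| <= e / M * `|s *: v|.
  by near: t; exact: near0_line approx.
have B : forall s, 0 <= s <= t -> O (s *: v + t *: w + x) /\ O (s *: v + x).
  by near: t; exact: near0_line inO.
pose phi s := F (x + t *: w + s *: v) - F (x + s *: v).
pose dphi s := 'D_v F (x + t *: w + s *: v) - 'D_v F (x + s *: v).
have dphiP s : 0 <= s <= t -> is_derive s 1 phi (dphi s).
  move=> st; have [Bw Bv] := B s st.
  rewrite /dphi -!derive_line_at; apply: is_deriveB; apply: derivableP;
    apply: derivable_line; apply: diff_derivable; apply: dF.
  - by rewrite addrC [x + _]addrC addrA.
  - by rewrite addrC.
have dphi_in s : s \in `]0, t[ -> is_derive s 1 phi (dphi s).
  by rewrite in_itv /= => /andP[s0 st]; apply: dphiP; rewrite !ltW.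
have cphi : {within `[0, t], continuous phi}.
  apply: derivable_within_continuous => s; rewrite in_itv /= => st.
  by have [] := dphiP s st.
have [xi + Dphi] := MVT t0 dphi_in cphi; rewrite in_itv /= => /andP[xi0 xit].
have xi0t : 0 <= xi <= t by rewrite !ltW.
have [A1 A2] := A xi xi0t.
have SD : second_difference v w t = dphi xi * t.
  rewrite -[t in RHS]subr0 -Dphi /phi /second_difference !scale0r !addr0.
  by rewrite [x + t *: w + t *: v]addrAC; ring.
have Ladd : L (xi *: v + t *: w) = L (xi *: v) + t * L w by rewrite linearD [L (t *: w)]linearZ.
have bound : `|dphi xi - t * L w| <= e * t.
  have -> : dphi xi - t * L w =
     ('D_v F (xi *: v + t *: w + x) - ('D_v F x + L (xi *: v + t *: w)))
     - ('D_v F (xi *: v + x) - ('D_v F x + L (xi *: v))).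
    rewrite Ladd /dphi [x + t *: w + _]addrC [x + t *: w]addrC addrA [x + xi *: v]addrC.
    ring.
  apply: le_trans (ler_normB _ _) _; apply: le_trans (lerD A1 A2) _.
  rewrite -mulrDr -mulrA ler_pM2l // ler_pdivrMl //.
  rewrite /M; apply: le_trans (lerD (ler_normD _ _) (lexx _)) _.
  rewrite !normrZ !ger0_norm ?(ltW t0) ?(ltW xi0) //.
  have : xi * `|v| <= t * `|v| by rewrite ler_wpM2r // ltW.
  nra.
rewrite SD [X in `|X|](_ : _ = t * (dphi xi - t * L w)); last by ring.
rewrite normrM (gtr0_norm t0) expr2 mulrCA ler_pM2l //.
Unshelve. all: by end_near.
Qed.

(** The second difference is symmetric in [v] and [w], and both mixed
derivatives are its limit after division by [t ^+ 2]. *)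
Lemma schwarz v w : differentiable ('D_v F) x -> differentiable ('D_w F) x ->
  'D_w ('D_v F) x = 'D_v ('D_w F) x.
Proof.
move=> dv dw; apply/eqP; rewrite -subr_eq0 -normr_le0; apply/ler_addgt0Pl => e e0.
rewrite addr0; have e2 : 0 < e / 2 by rewrite divr_gt0.
have Av := @second_difference_approx v w _ e2 dv.
have Aw := @second_difference_approx w v _ e2 dw.
have pos : \forall t \near (0:R)^'+, 0 < t by exact: nbhs_right_gt.
have [t [t0 [Hv Hw]]] := @filter_ex _ _ (at_right_proper_filter (0 : R)) _
  (@filterI _ _ _ _ _ pos (@filterI _ _ _ _ _ Av Aw)).
have sym : second_difference w v t = second_difference v w t.
  by rewrite /second_difference [x + t *: w + _]addrAC; ring.
rewrite sym in Hw; have t2 : 0 < t ^+ 2 by rewrite exprn_gt0.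
rewrite -(ler_pM2l t2) -[X in X * `|_|](gtr0_norm t2) -normrM.
move: ('D_w ('D_v F) x) ('D_v ('D_w F) x) (second_difference v w t) Hv Hw => A B C Hv Hw.
have -> : t ^+ 2 * (A - B) = (C - t ^+ 2 * B) - (C - t ^+ 2 * A) by ring.
by apply: le_trans (ler_normB _ _) _; apply: le_trans (lerD Hw Hv) _; lra.
Qed.
End Schwarz.

(** * Smooth functions of finite order on the jets *)
Section JetFunctions.
Variables (R : realType) (n : nat).
Local Notation jet := (jet R n).
Implicit Types (f g : jet -> R) (th : jet) (U : set jet).

(** The partial derivatives at a jet only see the coordinate lines through it,
so this is the openness that they require. *)
Definition line_open U := forall th j i, U th ->
  \forall s \near (0 : R), U (jet_shift th j i s).

Lemma jet_shift0 th j i : jet_shift th j i 0 = th.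
Proof.
by apply: funext => j'; rewrite /jet_shift; case: eqP => // _; rewrite scale0r addr0.
Qed.

Definition jderivable j i f th := derivable (fun s => f (jet_shift th j i s)) 0 1.

Section Rules.
Variables (j : nat) (i : 'I_n) (th : jet).

Lemma jpartialE f : jpartial j i f th = 'D_1 (fun s => f (jet_shift th j i s)) 0.
Proof. exact: derive1E. Qed.

Lemma jpartial_const (c : R) : jpartial j i (fun=> c) th = 0.
Proof. by rewrite jpartialE derive_cst. Qed.

Lemma jderivable_const (c : R) : jderivable j i (fun=> c) th.
Proof. exact: derivable_cst. Qed.

Lemma jpartialD f g : jderivable j i f th -> jderivable j i g th ->
  jpartial j i (fun th => f th + g th) th = jpartial j i f th + jpartial j i g th.
Proof. by move=> df dg; rewrite !jpartialE (deriveD df dg). Qed.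

Lemma jderivableD f g : jderivable j i f th -> jderivable j i g th ->
  jderivable j i (fun th => f th + g th) th.
Proof. by move=> df dg; exact: (derivableD df dg). Qed.

Lemma jpartialM f g : jderivable j i f th -> jderivable j i g th ->
  jpartial j i (fun th => f th * g th) th = jpartial j i f th * g th + f th * jpartial j i g th.
Proof.
move=> df dg; rewrite !jpartialE (deriveM df dg) jet_shift0 addrC.
by congr (_ + _); exact: mulrC.
Qed.

Lemma jderivableM f g : jderivable j i f th -> jderivable j i g th ->
  jderivable j i (fun th => f th * g th) th.
Proof. by move=> df dg; exact: (derivableM df dg). Qed.

Lemma jpartialV f : f th != 0 -> jderivable j i f th ->
  jpartial j i (fun th => (f th)^-1) th = - (jpartial j i f th * ((f th)^-1 * (f th)^-1)).
Proof.
move=> f0 df; rewrite !jpartialE deriveV ?jet_shift0 //.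
by rewrite [_ *: _]mulrC mulrN expr2 invfM.
Qed.

Lemma jderivableV f : f th != 0 -> jderivable j i f th ->
  jderivable j i (fun th => (f th)^-1) th.
Proof. by move=> f0 df; apply: derivableV => //; rewrite jet_shift0. Qed.

Lemma eq_jpartial U f g : line_open U -> U th -> (forall th, U th -> f th = g th) ->
  jpartial j i f th = jpartial j i g th.
Proof.
move=> oU Uth fg; rewrite !jpartialE; apply: near_eq_derive.
by apply: filterS (oU th j i Uth) => s; exact: fg.
Qed.

Lemma eq_jderivable U f g : line_open U -> U th -> (forall th, U th -> f th = g th) ->
  jderivable j i f th -> jderivable j i g th.
Proof.
move=> oU Uth fg; apply: near_eq_derivable.
by apply: filterS (oU th j i Uth) => s; exact: fg.
Qed.

Lemma jpartial_coord j' i' :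
  jpartial j i (fun th => th j' 0 i') th = ((j == j') && (i == i'))%:R /\
  jderivable j i (fun th => th j' 0 i') th.
Proof.
rewrite jpartialE /jderivable.
have -> : (fun s => jet_shift th j i s j' 0 i') =
    (fun s : R => th j' 0 i' + s *: (((j == j') && (i == i'))%:R : R)).
  apply: funext => s; rewrite /jet_shift eq_sym.
  case: (j =P j') => _ /=; last by rewrite scaler0 addr0.
  by rewrite !mxE eqxx /= eq_sym.
split; last by apply: (@derivable_line _ _ _ (fun x : R => x)); exact: derivable_id.
by rewrite -(@derive_line _ _ _ (fun x : R => x)) derive_id.
Qed.

End Rules.

(* Nested partial derivatives, unfolded into limits, are costly to compare. *)
Local Opaque jpartial.

Lemma trunc_shift m th j (i : 'I_n) s : trunc m (jet_shift th j i s) =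
  trunc m th + s *: (if (j <= m)%N then delta_mx (inord j) i else 0).
Proof.
apply/matrixP => k l; rewrite !mxE /jet_shift.
have [jm|mj] := leqP j m; last by rewrite ltn_eqF ?(leq_trans (ltn_ord k)) // mxE mulr0 addr0.
have -> : (nat_of_ord k == j) = (k == inord j) by rewrite -val_eqE /= inordK.
by rewrite mxE; case: (k =P inord j) => [kj|_]; rewrite ?mxE /= ?mulr0 ?addr0.
Qed.

Lemma line_open_trunc m (O : set 'M[R]_(m.+1, n)) : open O ->
  line_open [set th | O (trunc m th)].
Proof.
move=> oO th j i /= Oth.
pose d : 'M[R]_(m.+1, n) := if (j <= m)%N then delta_mx (inord j) i else 0.
have c0 : {for 0, continuous (fun s : R => trunc m th + s *: d)}.
  by apply: continuousD; [exact: cst_continuous | apply: scalel_continuous].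
have : \forall s \near (0 : R), O (trunc m th + s *: d).
  by apply: c0; rewrite scale0r addr0; exact: open_nbhs_nbhs.
by apply: filterS => s /=; rewrite trunc_shift.
Qed.

Lemma line_openI U U' : line_open U -> line_open U' -> line_open (U `&` U').
Proof.
move=> oU oU' th j i [Uth U'th].
by apply: filterS2 (oU th j i Uth) (oU' th j i U'th).
Qed.

(** The smooth functions on [U] of order at most [m], generated from smooth
functions of finitely many derivatives.  An inductive presentation gives the
closure under partial derivatives and their commutation by induction on the
construction, so that the symmetry of second derivatives is only used for the
constructor [jetfun_lift]. *)
Inductive jetfun U : nat -> (jet -> R) -> Prop :=
| jetfun_const m c : jetfun U m (fun=> c)
| jetfun_coord m j i : (j <= m)%N -> jetfun U m (fun th => th j 0 i)
| jetfun_lift m O F : open O -> smooth_on O F -> (forall th, U th -> O (trunc m th)) ->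
    jetfun U m (fun th => F (trunc m th))
| jetfunD m f g : jetfun U m f -> jetfun U m g -> jetfun U m (fun th => f th + g th)
| jetfunM m f g : jetfun U m f -> jetfun U m g -> jetfun U m (fun th => f th * g th)
| jetfunV m f : jetfun U m f -> (forall th, U th -> f th != 0) ->
    jetfun U m (fun th => (f th)^-1)
| eq_jetfun m f g : (forall th, U th -> f th = g th) -> jetfun U m f -> jetfun U m g
| jetfun_widen m m' f : (m <= m')%N -> jetfun U m f -> jetfun U m' f.

Lemma jetfun_sub U U' m f : U' `<=` U -> jetfun U m f -> jetfun U' m f.
Proof.
move=> sub; elim=> {m f}.
- by move=> m c; exact: jetfun_const.
- by move=> m j i jm; exact: jetfun_coord.
- by move=> m O F oO sF UO; apply: (jetfun_lift oO sF) => th /sub; exact: UO.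
- by move=> m f g _ IHf _ IHg; exact: jetfunD.
- by move=> m f g _ IHf _ IHg; exact: jetfunM.
- by move=> m f _ IHf f0; apply: jetfunV => // th /sub; exact: f0.
- by move=> m f g fg _ IHf; apply: eq_jetfun IHf => th /sub; exact: fg.
- by move=> m m' f mm' _; exact: jetfun_widen.
Qed.

Lemma jetfunN U m f : jetfun U m f -> jetfun U m (fun th => - f th).
Proof.
move=> jf; apply: (@eq_jetfun _ _ (fun th => -1 * f th)) => [th _|]; first by rewrite mulN1r.
by apply: jetfunM => //; exact: jetfun_const.
Qed.

Lemma jetfunB U m f g : jetfun U m f -> jetfun U m g -> jetfun U m (fun th => f th - g th).
Proof. by move=> jf jg; apply: jetfunD => //; exact: jetfunN. Qed.

Lemma jetfun_sum U m (J : Type) (r : seq J) (p : pred J) (F : J -> jet -> R) :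
  (forall k, p k -> jetfun U m (F k)) -> jetfun U m (fun th => \sum_(k <- r | p k) F k th).
Proof.
move=> jF; elim: r => [|k r IH].
  apply: (@eq_jetfun _ _ (fun=> 0)) => [th _|]; [by rewrite big_nil | exact: jetfun_const].
have [pk|npk] := boolP (p k); last first.
  by apply: eq_jetfun IH => th _; rewrite big_cons (negbTE npk).
apply: (@eq_jetfun _ _ (fun th => F k th + \sum_(k <- r | p k) F k th)) => [th _|].
  by rewrite big_cons pk.
by apply: jetfunD => //; exact: jF.
Qed.

Lemma jetfun_prod U m (J : Type) (r : seq J) (p : pred J) (F : J -> jet -> R) :
  (forall k, p k -> jetfun U m (F k)) -> jetfun U m (fun th => \prod_(k <- r | p k) F k th).
Proof.
move=> jF; elim: r => [|k r IH].
  apply: (@eq_jetfun _ _ (fun=> 1)) => [th _|]; [by rewrite big_nil | exact: jetfun_const].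
have [pk|npk] := boolP (p k); last first.
  by apply: eq_jetfun IH => th _; rewrite big_cons (negbTE npk).
apply: (@eq_jetfun _ _ (fun th => F k th * \prod_(k <- r | p k) F k th)) => [th _|].
  by rewrite big_cons pk.
by apply: jetfunM => //; exact: jF.
Qed.

Lemma jetfun_dep U m f th th' : jetfun U m f -> U th -> U th' ->
  (forall j, (j <= m)%N -> th j = th' j) -> f th = f th'.
Proof.
move=> jf Uth Uth'; elim: jf => {m f}.
- by [].
- by move=> m j i jm -> //.
- move=> m O F _ _ _ E; congr F; apply/matrixP => k l; rewrite !mxE E //.
  exact: (ltn_ord k).
- by move=> m f g _ IHf _ IHg E; rewrite IHf ?IHg.
- by move=> m f g _ IHf _ IHg E; rewrite IHf ?IHg.
- by move=> m f _ IHf _ E; rewrite IHf.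
- by move=> m f g fg _ IHf E; rewrite -!fg // IHf.
- by move=> m m' f mm' _ IHf E; apply: IHf => j jm; apply: E; exact: leq_trans jm mm'.
Qed.

Section OpenDomain.
Variable U : set jet.
Hypothesis oU : line_open U.

Lemma lift_jpartial m (O : set 'M[R]_(m.+1, n)) (F : 'M[R]_(m.+1, n) -> R) j i th :
  smooth_on O F -> O (trunc m th) ->
  jpartial j i (fun th => F (trunc m th)) th =
    'D_(if (j <= m)%N then delta_mx (inord j) i else 0) F (trunc m th) /\
  jderivable j i (fun th => F (trunc m th)) th.
Proof.
move=> sF Oth; rewrite jpartialE /jderivable.
have -> : (fun s => F (trunc m (jet_shift th j i s))) = (fun s =>
    F (trunc m th + s *: (if (j <= m)%N then delta_mx (inord j) i else 0))).
  by apply: funext => s; rewrite trunc_shift.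
split; first by rewrite -derive_line.
apply: derivable_line; apply: diff_derivable; rewrite scale0r addr0.
exact: (sF [::] _ Oth).
Qed.

Lemma smooth_derive (V W : normedModType R) (O : set V) (F : V -> W) v :
  smooth_on O F -> smooth_on O ('D_v F).
Proof.
move=> sF l x Ox; have := sF (rcons l v) x Ox.
by rewrite /iter_derive foldr_rcons.
Qed.

Lemma jetfun_jpartial j i m f : jetfun U m f ->
  jetfun U m (jpartial j i f) /\ forall th, U th -> jderivable j i f th.
Proof.
elim=> {m f}.
- move=> m c; split=> [|th _]; last exact: jderivable_const.
  apply: (@eq_jetfun _ _ (fun=> 0)); last exact: jetfun_const.
  by move=> th _; rewrite jpartial_const.
- move=> m j' i' jm; split=> [|th _]; last exact: (jpartial_coord _ _ _ _ _).2.
  apply: (@eq_jetfun _ _ (fun=> ((j == j') && (i == i'))%:R)); last exact: jetfun_const.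
  by move=> th _; rewrite (jpartial_coord _ _ _ _ _).1.
- move=> m O F oO sF UO; split=> [|th Uth]; last exact: (lift_jpartial j i sF (UO th Uth)).2.
  have sDF v := smooth_derive v sF.
  apply: eq_jetfun (jetfun_lift oO (sDF _) UO) => th Uth.
  by rewrite (lift_jpartial j i sF (UO th Uth)).1.
- move=> m f g jf [jDf df] jg [jDg dg]; split=> [|th Uth]; last by apply: jderivableD; auto.
  by apply: eq_jetfun (jetfunD jDf jDg) => th Uth; rewrite jpartialD //; auto.
- move=> m f g jf [jDf df] jg [jDg dg]; split=> [|th Uth]; last by apply: jderivableM; auto.
  apply: eq_jetfun (jetfunD (jetfunM jDf jg) (jetfunM jf jDg)) => th Uth.
  by rewrite jpartialM //; auto.
- move=> m f jf [jDf df] f0; split=> [|th Uth]; last by apply: jderivableV; auto.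
  have jV := jetfunV jf f0.
  apply: eq_jetfun (jetfunN (jetfunM jDf (jetfunM jV jV))) => th Uth.
  by rewrite jpartialV //; auto.
- move=> m f g fg jf [jDf df]; split=> [|th Uth]; last exact: (eq_jderivable oU Uth fg (df th Uth)).
  by apply: eq_jetfun jDf => th Uth; exact: (eq_jpartial _ _ oU Uth fg).
- by move=> m m' f mm' jf [jDf df]; split=> //; exact: jetfun_widen jDf.
Qed.

Lemma jetfun_partial j i m f : jetfun U m f -> jetfun U m (jpartial j i f).
Proof. by move=> /(jetfun_jpartial j i)[]. Qed.

Lemma jetfun_derivable j i m f th : jetfun U m f -> U th -> jderivable j i f th.
Proof. by move=> /(jetfun_jpartial j i)[_]; exact. Qed.

Lemma jpartial_high j i m f th : jetfun U m f -> (m < j)%N -> U th -> jpartial j i f th = 0.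
Proof.
move=> jf mj Uth; rewrite jpartialE.
rewrite (@near_eq_derive _ _ _ _ (fun=> f th)) ?derive_cst //.
apply: filterS (oU j i Uth) => s Us; apply: (jetfun_dep jf) => // k km.
by rewrite /jet_shift ltn_eqF // (leq_ltn_trans km).
Qed.

Lemma jpartialC j i j' i' m f th : jetfun U m f -> U th ->
  jpartial j i (jpartial j' i' f) th = jpartial j' i' (jpartial j i f) th.
Proof.
move=> jf; elim: jf th => {m f}.
- move=> m c th Uth.
  have E k l th' : U th' -> jpartial k l (fun=> c) th' = 0 by move=> _; exact: jpartial_const.
  apply: etrans (eq_jpartial j i oU Uth (E j' i')) _.
  apply: etrans _ (esym (eq_jpartial j' i' oU Uth (E j i))).
  by rewrite !jpartial_const.
- move=> m p q _ th Uth.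
  have E k l th' : U th' -> jpartial k l (fun th => th p 0 q) th' = ((k == p) && (l == q))%:R.
    by move=> _; exact: (jpartial_coord _ _ _ _ _).1.
  apply: etrans (eq_jpartial j i oU Uth (E j' i')) _.
  apply: etrans _ (esym (eq_jpartial j' i' oU Uth (E j i))).
  by rewrite !jpartial_const.
- move=> m O F oO sF UO th Uth.
  set d := if (j <= m)%N then delta_mx (inord j) i else 0 : 'M[R]_(m.+1, n).
  set d' := if (j' <= m)%N then delta_mx (inord j') i' else 0 : 'M[R]_(m.+1, n).
  have E k l th' : U th' -> jpartial k l (fun th => F (trunc m th)) th' =
      'D_(if (k <= m)%N then delta_mx (inord k) l else 0) F (trunc m th').
    by move=> Uth'; exact: (lift_jpartial k l sF (UO th' Uth')).1.
  apply: etrans (eq_jpartial j i oU Uth (E j' i')) _.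
  apply: etrans _ (esym (eq_jpartial j' i' oU Uth (E j i))).
  apply: etrans (lift_jpartial j i (smooth_derive d' sF) (UO th Uth)).1 _.
  apply: etrans _ (esym (lift_jpartial j' i' (smooth_derive d sF) (UO th Uth)).1).
  apply: (@schwarz _ _ _ O) => //; first exact: UO.
  + by move=> y Oy; exact: (sF [::] y Oy).
  + exact: (sF [:: d'] _ (UO th Uth)).
  + exact: (sF [:: d] _ (UO th Uth)).
- move=> m f g jf IHf jg IHg th Uth.
  have df k l := fun th => @jetfun_derivable k l _ _ th jf.
  have dg k l := fun th => @jetfun_derivable k l _ _ th jg.
  have E k l th' : U th' -> jpartial k l (fun th => f th + g th) th' =
     jpartial k l f th' + jpartial k l g th' by move=> ?; rewrite jpartialD //; auto.
  apply: etrans (eq_jpartial j i oU Uth (E j' i')) _.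
  apply: etrans _ (esym (eq_jpartial j' i' oU Uth (E j i))).
  have ddf k l k' l' := @jetfun_derivable k l _ _ th (jetfun_partial k' l' jf) Uth.
  have ddg k l k' l' := @jetfun_derivable k l _ _ th (jetfun_partial k' l' jg) Uth.
  apply: etrans (jpartialD (ddf j i j' i') (ddg j i j' i')) _.
  apply: etrans _ (esym (jpartialD (ddf j' i' j i) (ddg j' i' j i))).
  exact: (congr2 +%R (IHf th Uth) (IHg th Uth)).
- move=> m f g jf IHf jg IHg th Uth.
  have df k l := fun th => @jetfun_derivable k l _ _ th jf.
  have dg k l := fun th => @jetfun_derivable k l _ _ th jg.
  have ddf k l k' l' := @jetfun_derivable k l _ _ th (jetfun_partial k' l' jf) Uth.
  have ddg k l k' l' := @jetfun_derivable k l _ _ th (jetfun_partial k' l' jg) Uth.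
  have E k l th' : U th' -> jpartial k l (fun th => f th * g th) th' =
     jpartial k l f th' * g th' + f th' * jpartial k l g th'
    by move=> Uth'; exact: (jpartialM (df k l _ Uth') (dg k l _ Uth')).
  apply: etrans (eq_jpartial j i oU Uth (E j' i')) _.
  apply: etrans _ (esym (eq_jpartial j' i' oU Uth (E j i))).
  have dM k l k' l' := jderivableM (ddf k l k' l') (dg k l _ Uth).
  have dM' k l k' l' := jderivableM (df k l _ Uth) (ddg k l k' l').
  apply: etrans (jpartialD (dM j i j' i') (dM' j i j' i')) _.
  apply: etrans _ (esym (jpartialD (dM j' i' j i) (dM' j' i' j i))).
  rewrite (jpartialM (ddf j i j' i') (dg j i _ Uth)) (jpartialM (df j i _ Uth) (ddg j i j' i')).
  rewrite (jpartialM (ddf j' i' j i) (dg j' i' _ Uth)) (jpartialM (df j' i' _ Uth) (ddg j' i' j i)).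
  rewrite -(IHf _ Uth) -(IHg _ Uth).
  move: (jpartial j i (jpartial j' i' f) th) (jpartial j i (jpartial j' i' g) th) => F2 G2.
  move: (jpartial j i f th) (jpartial j i g th) (jpartial j' i' f th) (jpartial j' i' g th).
  by move=> a b a' b'; ring.
- move=> m f jf IHf f0 th Uth.
  have df k l := fun th => @jetfun_derivable k l _ _ th jf.
  have jV := jetfunV jf f0.
  have dV k l := fun th => @jetfun_derivable k l _ _ th jV.
  have ddf k l k' l' := @jetfun_derivable k l _ _ th (jetfun_partial k' l' jf) Uth.
  have E k l th' : U th' -> jpartial k l (fun th => (f th)^-1) th' =
     - 1 * (jpartial k l f th' * ((f th')^-1 * (f th')^-1)).
     by move=> ?; rewrite mulN1r jpartialV //; auto.
  apply: etrans (eq_jpartial j i oU Uth (E j' i')) _.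
  apply: etrans _ (esym (eq_jpartial j' i' oU Uth (E j i))).
  have dVV k l := jderivableM (dV k l _ Uth) (dV k l _ Uth).
  have dM k l k' l' := jderivableM (ddf k l k' l') (dVV k l).
  have dN k l := @jderivable_const k l th (-1).
  apply: etrans (jpartialM (dN j i) (dM j i j' i')) _.
  apply: etrans _ (esym (jpartialM (dN j' i') (dM j' i' j i))).
  rewrite (jpartialM (ddf j i j' i') (dVV j i)) (jpartialM (ddf j' i' j i) (dVV j' i')).
  rewrite (jpartialM (dV j i _ Uth) (dV j i _ Uth)) (jpartialM (dV j' i' _ Uth) (dV j' i' _ Uth)).
  rewrite (E j i _ Uth) (E j' i' _ Uth) !jpartial_const -(IHf _ Uth).
  move: (jpartial j i (jpartial j' i' f) th) (jpartial j i f th) (jpartial j' i' f th).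
  by move=> F2 a b; ring.
- move=> m f g fg jf IHf th Uth.
  have E k l th' : U th' -> jpartial k l g th' = jpartial k l f th'.
    by move=> Uth'; apply: (eq_jpartial _ _ oU Uth') => x Ux; rewrite fg.
  apply: etrans (eq_jpartial j i oU Uth (E j' i')) _.
  by apply: etrans _ (esym (eq_jpartial j' i' oU Uth (E j i))); exact: IHf.
- by [].
Qed.

End OpenDomain.
End JetFunctions.

Arguments jetfun_derivable {R n U} oU j i {m f th} _ _.

(** * Total derivatives and linearization along a jet *)
Section TotalDerivative.
Variables (R : realType) (n : nat) (U : set (jet R n)).
Hypothesis oU : line_open U.
Local Notation jet := (jet R n).
Implicit Types (f g : jet -> R) (th : jet).

Lemma fsbig_bounded (Z : zmodType) N (F : nat -> Z) :
  (forall j, (N <= j)%N -> F j = 0) -> \sum_(j \in [set: nat]) F j = \sum_(j < N) F j.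
Proof.
move=> F0; rewrite fsbig_ord; apply/esym/fsbig_widen => // j /= [_ /negP].
by rewrite -leqNgt; exact: F0.
Qed.

Lemma tderivE N m f th : jetfun U m f -> (m < N)%N -> U th ->
  tderiv f th = \sum_(j < N) \sum_i th j.+1 0 i * jpartial j i f th.
Proof.
move=> jf mN Uth; apply: fsbig_bounded => j Nj; rewrite big1 // => i _.
by rewrite (jpartial_high oU i jf (leq_trans mN Nj) Uth) mulr0.
Qed.

Lemma eq_tderiv f g th : (forall th, U th -> f th = g th) -> U th ->
  tderiv f th = tderiv g th.
Proof.
move=> fg Uth; apply: eq_fsbigr => j _; apply: eq_bigr => i _; congr (_ * _).
exact: (eq_jpartial j i oU Uth fg).
Qed.

Lemma jetfun_tderiv m f : jetfun U m f -> jetfun U m.+1 (tderiv f).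
Proof.
move=> jf; have E th : U th -> \sum_(j < m.+1) \sum_i th j.+1 0 i * jpartial j i f th = tderiv f th.
  by move=> Uth; rewrite (tderivE jf (ltnSn m) Uth).
apply: (eq_jetfun E); apply: jetfun_sum => j _; apply: jetfun_sum => i _.
apply: jetfunM; first by apply: jetfun_coord; exact: (ltn_ord j).
by apply: (@jetfun_widen _ _ _ m) => //; exact: jetfun_partial.
Qed.

Lemma tderivD m f g th : jetfun U m f -> jetfun U m g -> U th ->
  tderiv (fun th => f th + g th) th = tderiv f th + tderiv g th.
Proof.
move=> jf jg Uth; have mm := ltnSn m.
rewrite (tderivE (jetfunD jf jg) mm Uth) (tderivE jf mm Uth) (tderivE jg mm Uth).
rewrite -big_split; apply: eq_bigr => j _; rewrite -big_split; apply: eq_bigr => i _ /=.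
by rewrite (jpartialD (jetfun_derivable oU j i jf Uth) (jetfun_derivable oU j i jg Uth)) mulrDr.
Qed.

Lemma tderivM m f g th : jetfun U m f -> jetfun U m g -> U th ->
  tderiv (fun th => f th * g th) th = tderiv f th * g th + f th * tderiv g th.
Proof.
move=> jf jg Uth; have mm := ltnSn m.
rewrite (tderivE (jetfunM jf jg) mm Uth) (tderivE jf mm Uth) (tderivE jg mm Uth).
rewrite mulr_suml mulr_sumr -big_split; apply: eq_bigr => j _.
rewrite mulr_suml mulr_sumr -big_split; apply: eq_bigr => i _ /=.
rewrite (jpartialM (jetfun_derivable oU j i jf Uth) (jetfun_derivable oU j i jg Uth)) mulrDr.
by rewrite mulrA; congr (_ + _); rewrite mulrCA.
Qed.

Lemma tderiv_const c th : tderiv (fun=> c) th = 0 :> R.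
Proof.
rewrite /tderiv fsbig1 // => j _; rewrite big1 // => i _.
by rewrite jpartial_const mulr0.
Qed.

Lemma tderiv_coord j i th : tderiv (fun th => th j 0 i) th = th j.+1 0 i.
Proof.
rewrite /tderiv (@fsbig_bounded _ j.+1) => [|k jk]; last first.
  by rewrite big1 // => l _; rewrite (jpartial_coord _ _ _ _ _).1 gtn_eqF // mulr0.
rewrite big_ord_recr /= big1 => [|k _]; last first.
  rewrite big1 // => l _; rewrite (jpartial_coord _ _ _ _ _).1.
  by rewrite ltn_eqF ?mulr0.
rewrite add0r (bigD1 i) //= (jpartial_coord _ _ _ _ _).1 !eqxx mulr1 big1 ?addr0 // => l li.
by rewrite (jpartial_coord _ _ _ _ _).1 (negbTE li) andbF mulr0.
Qed.

Lemma eq_iter_tderiv k f g : (forall th, U th -> f th = g th) ->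
  forall th, U th -> iter k (@tderiv R n) f th = iter k (@tderiv R n) g th.
Proof. by move=> fg; elim: k => //= k IH th Uth; exact: eq_tderiv. Qed.

Lemma jetfun_iter_tderiv k m f : jetfun U m f -> jetfun U (k + m) (iter k (@tderiv R n) f).
Proof. by move=> jf; elim: k => //= k; exact: jetfun_tderiv. Qed.

Lemma iter_tderivD k m f g th : jetfun U m f -> jetfun U m g -> U th ->
  iter k (@tderiv R n) (fun th => f th + g th) th =
  iter k (@tderiv R n) f th + iter k (@tderiv R n) g th.
Proof.
move=> jf jg; elim: k th => //= k IH th Uth.
rewrite (eq_tderiv IH Uth); apply: (@tderivD (k + m)) => //; exact: jetfun_iter_tderiv.
Qed.

Lemma iter_tderiv0 k th : U th -> iter k (@tderiv R n) (fun=> 0) th = 0.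
Proof.
elim: k th => //= k IH th Uth.
by rewrite (eq_tderiv IH Uth) tderiv_const.
Qed.

(** The commutator of a partial derivative with the total derivative.  The
second term comes from the explicit factor [x^(j)] in the total derivative. *)
Lemma jpartial_tderiv j i m f th : jetfun U m f -> U th ->
  jpartial j i (tderiv f) th =
  tderiv (jpartial j i f) th + (if j is j'.+1 then jpartial j' i f th else 0).
Proof.
move=> jf Uth; pose N := (maxn m j).+1.
have mN : (m < N)%N by rewrite ltnS leq_maxl.
rewrite (eq_jpartial j i oU Uth (fun th => tderivE jf mN)).
have jterm (l : 'I_N) k : jetfun U N (fun th => th l.+1 0 k * jpartial l k f th).
  apply: jetfunM; first by apply: jetfun_coord; exact: (ltn_ord l).
  by apply: (@jetfun_widen _ _ _ m); [exact: ltnW | exact: jetfun_partial].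
have dsum (J : Type) (r : seq J) (F : J -> jet -> R) : (forall x, jetfun U N (F x)) ->
    jpartial j i (fun th => \sum_(x <- r) F x th) th = \sum_(x <- r) jpartial j i (F x) th.
  move=> jF; elim: r => [|x r IH].
    have E : forall th', U th' -> \sum_(x <- [::]) F x th' = 0 by move=> *; rewrite big_nil.
    by rewrite (eq_jpartial j i oU Uth E) jpartial_const big_nil.
  have E th' : U th' -> \sum_(y <- x :: r) F y th' = F x th' + \sum_(y <- r) F y th'.
    by rewrite big_cons.
  rewrite (eq_jpartial j i oU Uth E) big_cons -IH.
  have jsum : jetfun U N (fun th => \sum_(y <- r) F y th) by apply: jetfun_sum.
  exact: (jpartialD (jetfun_derivable oU j i (jF x) Uth) (jetfun_derivable oU j i jsum Uth)).
rewrite dsum => [|l]; last by apply: jetfun_sum => k _; exact: jterm.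
under eq_bigr do rewrite dsum //.
have termE (l : 'I_N) k : jpartial j i (fun th => th l.+1 0 k * jpartial l k f th) th =
    th l.+1 0 k * jpartial l k (jpartial j i f) th +
    ((j == l.+1) && (i == k))%:R * jpartial l k f th.
  rewrite (jpartialM (jpartial_coord _ _ _ _ _).2
    (jetfun_derivable oU j i (jetfun_partial oU l k jf) Uth)).
  by rewrite (jpartial_coord _ _ _ _ _).1 (jpartialC oU _ _ _ _ jf Uth) addrC.
under eq_bigr do under eq_bigr do rewrite termE.
under eq_bigr do rewrite big_split /=.
rewrite big_split /= -(tderivE (jetfun_partial oU j i jf) mN Uth); congr (_ + _).
case: j @N mN jterm dsum termE => [|j] N mN _ _ _.
  by rewrite big1 // => l _; rewrite big1 // => k _; rewrite mul0r.
have jN : (j < N)%N by rewrite ltnS leq_max leqnSn orbT.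
rewrite (bigD1 (Ordinal jN)) //= (bigD1 i) //= !eqxx mul1r big1 => [|k ki]; last first.
  by rewrite [i == k]eq_sym (negbTE ki) andbF mul0r.
rewrite addr0 big1 ?addr0 // => l lj; rewrite big1 // => k _.
rewrite (_ : (j.+1 == l.+1) = false) ?mul0r //.
by rewrite eqSS eq_sym; apply: contraNF lj.
Qed.

Variable th : jet.
Hypothesis Uth : U th.
Local Notation A := (hseries R).
Local Notation D := (@hderiv R).

(** The Taylor series of [f] along a formal curve whose jet is [th]; the
total derivative becomes the derivation of series. *)
Definition taylor f : A := fun k => iter k (@tderiv R n) f th.

Lemma taylor_tderiv f : taylor (tderiv f) = D (taylor f).
Proof. by apply: funext => k; rewrite /taylor /hderiv iterSr. Qed.

Lemma eq_taylor f g : (forall th, U th -> f th = g th) -> taylor f = taylor g.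
Proof. by move=> fg; apply: funext => k; exact: eq_iter_tderiv. Qed.

Lemma taylorD m f g : jetfun U m f -> jetfun U m g ->
  taylor (fun th => f th + g th) = taylor f + taylor g.
Proof. by move=> jf jg; apply: funext => k; exact: (iter_tderivD k jf jg). Qed.

Lemma taylor_const c : taylor (fun=> c) = hconst c.
Proof.
apply: funext => -[|k] //; rewrite /taylor iterSr.
rewrite (@eq_iter_tderiv k _ (fun=> 0)) // => [|th' _]; last exact: tderiv_const.
exact: iter_tderiv0.
Qed.

Lemma taylorM m f g : jetfun U m f -> jetfun U m g ->
  taylor (fun th => f th * g th) = taylor f * taylor g.
Proof.
move=> jf jg; apply: funext => k; elim: k m f g jf jg => // k IH m f g jf jg.
have jDf := jetfun_tderiv jf; have jDg := jetfun_tderiv jg.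
have jf' := jetfun_widen (leqnSn m) jf; have jg' := jetfun_widen (leqnSn m) jg.
change (D (taylor (fun th => f th * g th)) k = D (taylor f * taylor g) k).
rewrite -taylor_tderiv (eq_taylor (fun th Uth => tderivM jf jg Uth)).
rewrite (taylorD (jetfunM jDf jg') (jetfunM jf' jDg)) hderivM !coefhD.
by rewrite (IH _ _ _ jDf jg') (IH _ _ _ jf' jDg) !taylor_tderiv.
Qed.

Lemma taylor_sum m (J : Type) (r : seq J) (F : J -> jet -> R) :
  (forall x, jetfun U m (F x)) ->
  taylor (fun th => \sum_(x <- r) F x th) = \sum_(x <- r) taylor (F x).
Proof.
move=> jF; elim: r => [|x r IH].
  rewrite big_nil (@eq_taylor _ (fun=> 0)) => [|th' _]; last by rewrite big_nil.
  by rewrite taylor_const hconst0.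
rewrite big_cons -IH -(taylorD (m := m)) //; last exact: jetfun_sum.
by apply: eq_taylor => th' _; rewrite big_cons.
Qed.

Lemma taylor_iter k f : taylor (iter k (@tderiv R n) f) = iter k D (taylor f).
Proof. by elim: k => //= k <-; exact: taylor_tderiv. Qed.

(** The first variation of [f] at [th] in the direction of the formal vector
field [v] along the curve. *)
Definition linearize f (v : 'rV[A]_n) : A :=
  \sum_(j \in [set: nat]) \sum_i taylor (jpartial j i f) * iter j D (v 0 i).

Lemma linearizeE N m f v : jetfun U m f -> (m < N)%N ->
  linearize f v = \sum_(j < N) \sum_i taylor (jpartial j i f) * iter j D (v 0 i).
Proof.
move=> jf mN; apply: fsbig_bounded => j Nj; rewrite big1 // => i _.
rewrite (@eq_taylor _ (fun=> 0)) => [|th' Uth']; last first.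
  exact: (jpartial_high oU i jf (leq_trans mN Nj) Uth').
by rewrite taylor_const hconst0 mul0r.
Qed.

Lemma eq_linearize f g v : (forall th, U th -> f th = g th) -> linearize f v = linearize g v.
Proof.
move=> fg; apply: eq_fsbigr => j _; apply: eq_bigr => i _; congr (_ * _).
by apply: eq_taylor => th' Uth'; exact: (eq_jpartial j i oU Uth' fg).
Qed.

Lemma linearize_const c v : linearize (fun=> c) v = 0.
Proof.
rewrite (linearizeE v (jetfun_const U 0 c) (ltnSn 0)) big_ord1 big1 // => i _.
rewrite (@eq_taylor _ (fun=> 0)) => [|th' _]; last exact: jpartial_const.
by rewrite taylor_const hconst0 mul0r.
Qed.

Lemma linearizeD m f g v : jetfun U m f -> jetfun U m g ->
  linearize (fun th => f th + g th) v = linearize f v + linearize g v.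
Proof.
move=> jf jg; have mm := ltnSn m.
rewrite (linearizeE v (jetfunD jf jg) mm) (linearizeE v jf mm) (linearizeE v jg mm).
rewrite -big_split; apply: eq_bigr => j _; rewrite -big_split; apply: eq_bigr => i _ /=.
rewrite -mulrDl -(taylorD (m := m)); [|exact: jetfun_partial..].
congr (_ * _); apply: eq_taylor => th' Uth'.
exact: (jpartialD (jetfun_derivable oU j i jf Uth') (jetfun_derivable oU j i jg Uth')).
Qed.

Lemma linearizeM m f g v : jetfun U m f -> jetfun U m g ->
  linearize (fun th => f th * g th) v = taylor f * linearize g v + taylor g * linearize f v.
Proof.
move=> jf jg; have mm := ltnSn m.
rewrite (linearizeE v (jetfunM jf jg) mm) (linearizeE v jf mm) (linearizeE v jg mm).
rewrite !mulr_sumr -big_split; apply: eq_bigr => j _.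
rewrite !mulr_sumr -big_split; apply: eq_bigr => i _ /=.
have jDf := jetfun_partial oU j i jf; have jDg := jetfun_partial oU j i jg.
have E th' : U th' -> jpartial j i (fun th => f th * g th) th' =
    f th' * jpartial j i g th' + g th' * jpartial j i f th'.
  move=> Uth'.
  rewrite (jpartialM (jetfun_derivable oU j i jf Uth') (jetfun_derivable oU j i jg Uth')).
  by rewrite addrC [_ * g th']mulrC.
rewrite (eq_taylor E) (taylorD (jetfunM jf jDg) (jetfunM jg jDf)).
by rewrite (taylorM jf jDg) (taylorM jg jDf) mulrDl !mulrA.
Qed.

Lemma linearize_sum m (J : Type) (r : seq J) (F : J -> jet -> R) v :
  (forall x, jetfun U m (F x)) ->
  linearize (fun th => \sum_(x <- r) F x th) v = \sum_(x <- r) linearize (F x) v.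
Proof.
move=> jF; elim: r => [|x r IH].
  by rewrite big_nil (@eq_linearize _ (fun=> 0)) ?linearize_const // => th' _; rewrite big_nil.
rewrite big_cons -IH -(linearizeD (m := m)) //; last exact: jetfun_sum.
by apply: eq_linearize => th' _; rewrite big_cons.
Qed.

(** Variations commute with the derivation along the curve: the additional
term of [jpartial_tderiv] accounts for the derivative of [v]. *)
Lemma linearize_tderiv m f v : jetfun U m f -> linearize (tderiv f) v = D (linearize f v).
Proof.
move=> jf; rewrite (linearizeE v (jetfun_tderiv jf) (ltnSn _)) (linearizeE v jf (leqW (ltnSn m))).
have E j i : taylor (jpartial j i (tderiv f)) = D (taylor (jpartial j i f)) +
    (if j is j'.+1 then taylor (jpartial j' i f) else 0).
  rewrite (eq_taylor (fun th Uth => jpartial_tderiv j i jf Uth)) -taylor_tderiv.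
  have jD := jetfun_tderiv (jetfun_partial oU j i jf).
  case: j jD => [|j] jD; last first.
    by rewrite (taylorD jD (jetfun_widen (leqnSn m) (jetfun_partial oU j i jf))).
  by rewrite addr0; apply: eq_taylor => th' _; rewrite addr0.
under eq_bigr do under eq_bigr do rewrite E mulrDl.
under eq_bigr do rewrite big_split /=.
rewrite hderiv_sum; under [RHS]eq_bigr do rewrite hderiv_sum.
under [RHS]eq_bigr do under eq_bigr do rewrite hderivM.
under [RHS]eq_bigr do rewrite big_split /=.
rewrite !big_split /=; congr (_ + _).
rewrite big_ord_recl big1 => [|i _]; last by rewrite mul0r.
rewrite add0r [RHS]big_ord_recr /= [X in _ + X]big1 ?addr0 // => i _.
rewrite (@eq_taylor _ (fun=> 0)) => [|th' Uth']; last first.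
  exact: (jpartial_high oU i jf (ltnSn m) Uth').
by rewrite taylor_const hconst0 mul0r.
Qed.

Lemma linearize_iter k m f v : jetfun U m f ->
  linearize (iter k (@tderiv R n) f) v = iter k D (linearize f v).
Proof.
by move=> jf; elim: k => //= k <-; exact: (linearize_tderiv v (jetfun_iter_tderiv k jf)).
Qed.

End TotalDerivative.

(** * Systems of odd total order are not variational *)
Section OddOrderSystems.
Variables (R : realType) (n : nat).
Local Notation jet := (jet R n).
Local Notation A := (hseries R).
Local Notation D := (@hderiv R).
Local Notation td := (@tderiv R n).

Lemma iter_hderiv0 k : iter k D 0 = 0.
Proof. by elim: k => //= k ->. Qed.

(** At a jet where the prolonged equation [E = 0] holds, the variation of the
coefficients does not contribute; so the linearization of [F] is a differential
operator applied to the linearization of [E]. *)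
Lemma diff_consequence_linearize (U : set jet) (E F : 'I_n -> jet -> R) me th :
  line_open U -> (forall j, jetfun U me (E j)) -> diff_consequence U E F ->
  U th -> (forall j, taylor th (E j) = 0) -> forall k,
  taylor th (F k) = 0 /\ exists N (c : 'I_N -> 'I_n -> A), forall v,
    linearize th (F k) v = \sum_i \sum_j c i j * iter i D (linearize th (E j) v).
Proof.
move=> oU jE cons Uth E0 k; have [m [N [dom [c [oO Oth sc FE]]]]] := cons th Uth.
pose U' : set jet := U `&` [set th | dom (trunc m th)].
have oU' : line_open U' by apply: line_openI => //; exact: line_open_trunc.
have U'th : U' th by [].
have FE' th' : U' th' -> F k th' =
    \sum_(i < N) \sum_j c k i j (trunc m th') * iter i td (E j) th'.
  by move=> [Uth' Oth']; exact: FE.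
pose M := (m + (N + me))%N.
have jc i j : jetfun U' M (fun th => c k i j (trunc m th)).
  by apply: (jetfun_widen (leq_addr _ m)); apply: (jetfun_lift oO (sc k i j)) => x [].
have jE' j : jetfun U' me (E j) by apply: jetfun_sub (jE j) => x [].
have jiE (i : 'I_N) j : jetfun U' M (iter i td (E j)).
  apply: jetfun_widen (jetfun_iter_tderiv oU' i (jE' j)).
  by rewrite (leq_trans _ (leq_addl m _)) // leq_add2r ltnW.
have jterm (i : 'I_N) j := jetfunM (jc i j) (jiE i j).
have jsum i := jetfun_sum (index_enum 'I_n) (fun j (_ : true) => jterm i j).
have tiE (i : 'I_N) j : taylor th (iter i td (E j)) = 0.
  by rewrite taylor_iter E0 iter_hderiv0.
split.
  rewrite (eq_taylor oU' U'th FE') (taylor_sum oU' U'th _ jsum) big1 // => i _.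
  rewrite (taylor_sum oU' U'th _ (jterm i)) big1 // => j _.
  by rewrite (taylorM oU' U'th (jc i j) (jiE i j)) tiE mulr0.
exists N, (fun i j => taylor th (fun th => c k i j (trunc m th))) => v.
rewrite (eq_linearize oU' U'th v FE') (linearize_sum oU' U'th _ v jsum); apply: eq_bigr => i _.
rewrite (linearize_sum oU' U'th _ v (jterm i)); apply: eq_bigr => j _.
rewrite (linearizeM oU' U'th v (jc i j) (jiE i j)) tiE mul0r addr0.
by rewrite (linearize_iter oU' U'th i v (jE' j)).
Qed.

Section Equation.
Variables (U : set jet) (m : nat) (r F : 'I_n -> jet -> R).
Hypothesis oU : line_open U.
Hypothesis jr : forall k, jetfun U m (r k).
Hypothesis FE : forall th k, U th -> F k th = th m.+1 0 k + r k th.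

Lemma jetfun_solved k : jetfun U m.+1 (F k).
Proof.
apply: (@eq_jetfun _ _ _ _ (fun th => th m.+1 0 k + r k th)) => [th Uth|].
  by rewrite FE.
by apply: jetfunD; [exact: jetfun_coord | exact: jetfun_widen (jr k)].
Qed.

Lemma iter_tderiv_coord l j (k : 'I_n) th :
  iter l td (fun th => th j 0 k) th = th (l + j)%N 0 k.
Proof.
elim: l th => //= l IH th.
by rewrite (_ : iter l td _ = fun th => th (l + j)%N 0 k) ?tderiv_coord //; apply: funext.
Qed.

Hypothesis U_low : forall th th', (forall j, (j <= m)%N -> th j = th' j) -> U th -> U th'.

(** The prolonged equation determines each derivative of order above [m] from
the lower ones, while membership in [U] depends only on the derivatives up to
order [m]. *)
Lemma equation_jet : U !=set0 -> exists2 th, U th & forall k, taylor th (F k) = 0.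
Proof.
move=> [th0 Uth0].
pose low (th : jet) : jet := fun s => if (s <= m)%N then th0 s else th s.
have Ulow th : U (low th) by apply: U_low Uth0 => j jm; rewrite /low jm.
pose Phi (th : jet) : jet := fun t => if (t <= m)%N then th0 t
  else - \row_k iter (t - m.+1) td (r k) (low th).
have causal f g t : (forall j, (j < t)%N -> f j = g j) -> Phi f t = Phi g t.
  move=> fg; rewrite /Phi; case: leqP => // mt; congr (- _); apply/rowP => k; rewrite !mxE.
  apply: (jetfun_dep (jetfun_iter_tderiv oU (t - m.+1) (jr k)) (Ulow f) (Ulow g)) => j jm.
  rewrite /low; case: ifP => // _; apply: fg; rewrite (leq_ltn_trans jm) //.
  by rewrite -{2}(subnK mt) addnS ltnSn.
have [th thE] := causal_fixpoint (fun=> 0) causal.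
have lowE : low th = th.
  by apply: funext => s; rewrite /low; case: leqP => // sm; rewrite thE /Phi sm.
have Uth : U th by rewrite -lowE.
exists th => // k; apply: funext => l.
rewrite /taylor (eq_iter_tderiv oU l (fun th => FE k (th := th)) Uth).
rewrite (iter_tderivD oU l (jetfun_coord U k (leqnn m.+1)) (jetfun_widen (leqnSn m) (jr k)) Uth).
rewrite iter_tderiv_coord thE /Phi leqNgt addnS ltnS leq_addl /= lowE !mxE.
by rewrite subSS addnK addNr.
Qed.

Variable th : jet.
Hypothesis Uth : U th.

Lemma linearize_coord j k v : linearize th (fun th => th j 0 k) v = iter j D (v 0 k).
Proof.
rewrite (linearizeE oU Uth v (jetfun_coord U k (leqnn j)) (ltnSn j)).
have T l i : taylor th (jpartial l i (fun th => th j 0 k)) = hconst ((l == j) && (i == k))%:R.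
  rewrite -(taylor_const oU Uth); apply: (eq_taylor oU Uth) => th' _.
  exact: (jpartial_coord _ _ _ _ _).1.
under eq_bigr do under eq_bigr do rewrite T.
rewrite big_ord_recr /= big1 => [|l _]; last first.
  by rewrite big1 // => i _; rewrite ltn_eqF // hconst0 mul0r.
rewrite add0r (bigD1 k) //= !eqxx big1 => [|i ik].
  by rewrite addr0; exact: mul1r.
by rewrite (negbTE ik) andbF hconst0 mul0r.
Qed.

Lemma linearize_solved k v : linearize th (F k) v =
  monic_system (fun l : 'I_m.+1 => \matrix_(i, k) taylor th (jpartial l i (r k))) v 0 k.
Proof.
rewrite (eq_linearize oU Uth v (fun th => FE k (th := th))).
rewrite (linearizeD oU Uth v (jetfun_coord U k (leqnn m.+1)) (jetfun_widen (leqnSn m) (jr k))).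
rewrite linearize_coord mxE (linearizeE oU Uth v (jr k) (ltnSn m)); congr (_ + _).
by apply: eq_bigr => l _; apply: eq_bigr => i _; rewrite mxE.
Qed.

End Equation.

Section EulerLagrange.
Variables (U : set jet) (m : nat) (L : jet -> R).
Hypothesis oU : line_open U.
Hypothesis jL : jetfun U m L.

Lemma euler_lagrangeE k th : U th -> euler_lagrange L k th =
  \sum_(j < m.+1) (-1) ^+ j * iter j td (jpartial j k L) th.
Proof.
move=> Uth; apply: fsbig_bounded => j mj.
rewrite (eq_iter_tderiv oU j (g := fun=> 0) _ Uth) ?(iter_tderiv0 oU _ Uth) ?mulr0 // => th' Uth'.
exact: (jpartial_high oU k jL mj Uth').
Qed.

Let jterm k (j : 'I_m.+1) :
  jetfun U (m + m) (fun th => (-1) ^+ j * iter j td (jpartial j k L) th).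
Proof.
apply: jetfunM; first exact: jetfun_const.
apply: jetfun_widen (jetfun_iter_tderiv oU j (jetfun_partial oU j k jL)).
by rewrite leq_add2r -ltnS.
Qed.

Lemma jetfun_euler_lagrange k : jetfun U (m + m) (euler_lagrange L k).
Proof.
apply: (@eq_jetfun _ _ _ _ (fun th => \sum_(j < m.+1) (-1) ^+ j * iter j td (jpartial j k L) th)).
  by move=> th Uth; rewrite euler_lagrangeE.
by apply: jetfun_sum => j _; exact: jterm.
Qed.

Lemma hconst_sign j : hconst ((-1) ^+ j : R) = (-1) ^+ j.
Proof.
elim: j => [//|j IH]; rewrite !exprS -IH !mulN1r.
by apply: funext => -[|k] //; rewrite /= coefhN /= oppr0.
Qed.

Lemma linearize_euler_lagrange th k v : U th -> linearize th (euler_lagrange L k) v =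
  hessian_system (fun p q : 'I_m.+1 * 'I_n =>
    taylor th (jpartial q.1 q.2 (jpartial p.1 p.2 L))) v 0 k.
Proof.
move=> Uth; rewrite (eq_linearize oU Uth v (fun th => euler_lagrangeE k (th := th))).
rewrite (linearize_sum oU Uth _ v (jterm k)) mxE; apply: eq_bigr => j _.
have jD := jetfun_partial oU j k jL; have jiD := jetfun_iter_tderiv oU j jD.
rewrite (linearizeM oU Uth v (jetfun_const U _ _) jiD).
rewrite (taylor_const oU Uth) hconst_sign (linearize_const oU Uth) mulr0 addr0.
rewrite (linearize_iter oU Uth j v jD) (linearizeE oU Uth v jD (ltnSn m)); congr (_ * iter _ _ _).
by rewrite pair_bigA.
Qed.

End EulerLagrange.

(** At a jet of the prolonged equation, equivalence makes the linearizations of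
both systems differential consequences of each other; the monic one has a
solution space of odd dimension and the other is self-adjoint. *)
Theorem odd_order_not_variational (U : set jet) m (r F : 'I_n -> jet -> R) mL L :
  line_open U -> U !=set0 ->
  (forall th th', (forall j, (j <= m)%N -> th j = th' j) -> U th -> U th') ->
  (forall k, jetfun U m (r k)) ->
  (forall th k, U th -> F k th = th m.+1 0 k + r k th) ->
  odd (m.+1 * n) -> jetfun U mL L ->
  ~ equivalent_systems U (euler_lagrange L) F.
Proof.
move=> oU U0 Ulow jr FE odd_mn jL [ELF FEL].
have [th Uth F0] := equation_jet oU jr FE Ulow U0.
have jF := jetfun_solved jr FE; have jEL := jetfun_euler_lagrange oU jL.
have EL := diff_consequence_linearize oU jF FEL Uth F0.
have FL := diff_consequence_linearize oU jEL ELF Uth (fun k => (EL k).1).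
pose a (l : 'I_m.+1) : 'M[A]_n := \matrix_(i, k) taylor th (jpartial l i (r k)).
pose H (p q : 'I_mL.+1 * 'I_n) := taylor th (jpartial q.1 q.2 (jpartial p.1 p.2 L)).
apply: (@odd_system_not_selfadjoint _ _ _ a _ H _ odd_mn).
- by move=> p q; apply: (eq_taylor oU Uth) => th' Uth'; exact: (jpartialC oU _ _ _ _ jL Uth').
- move=> v Fv; apply/rowP => k; rewrite -(linearize_euler_lagrange oU jL k v Uth) mxE.
  have [_ [N [c ->]]] := EL k; rewrite big1 // => i _; rewrite big1 // => j _.
  by rewrite (linearize_solved oU jr FE Uth) -/a Fv mxE iter_hderiv0 mulr0.
- move=> k; have [_ [N [c FLk]]] := FL k.
  exists (fun w => \sum_i \sum_j c i j * iter i D (coord j w)).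
    apply: diffop_sum => i _; apply: diffop_sum => j _; apply: diffopZ.
    by apply: diffop_iter; exact: diffop_gen.
  move=> v; rewrite -(linearize_solved oU jr FE Uth) FLk.
  apply: eq_bigr => i _; apply: eq_bigr => j _.
  by rewrite (linearize_euler_lagrange oU jL j v Uth).
Qed.

End OddOrderSystems.

(** * The equation of conformal geodesics in normal form *)
Section JetMatrices.
Variables (R : realType) (n : nat) (U : set (jet R n)).

Definition jetmx m p q (X : jet R n -> 'M[R]_(p, q)) :=
  forall i j, jetfun U m (fun th => X th i j).

Lemma jetmx_widen m m' p q (X : jet R n -> 'M[R]_(p, q)) :
  (m <= m')%N -> jetmx m X -> jetmx m' X.
Proof. by move=> mm jX i j; exact: jetfun_widen (jX i j). Qed.

Lemma eq_jetmx m p q (X Y : jet R n -> 'M[R]_(p, q)) :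
  (forall th, U th -> X th = Y th) -> jetmx m X -> jetmx m Y.
Proof. by move=> XY jX i j; apply: eq_jetfun (jX i j) => th Uth; rewrite XY. Qed.

Lemma jetmxD m p q (X Y : jet R n -> 'M[R]_(p, q)) :
  jetmx m X -> jetmx m Y -> jetmx m (fun th => X th + Y th).
Proof.
move=> jX jY i j; apply: eq_jetfun (jetfunD (jX i j) (jY i j)) => th _.
by rewrite mxE.
Qed.

Lemma jetmxB m p q (X Y : jet R n -> 'M[R]_(p, q)) :
  jetmx m X -> jetmx m Y -> jetmx m (fun th => X th - Y th).
Proof.
move=> jX jY i j; apply: eq_jetfun (jetfunB (jX i j) (jY i j)) => th _.
by rewrite !mxE.
Qed.

Lemma jetmxZ m p q (f : jet R n -> R) (X : jet R n -> 'M[R]_(p, q)) :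
  jetfun U m f -> jetmx m X -> jetmx m (fun th => f th *: X th).
Proof.
move=> jf jX i j; apply: eq_jetfun (jetfunM jf (jX i j)) => th _.
by rewrite mxE.
Qed.

Lemma jetmxM m p q s (X : jet R n -> 'M[R]_(p, q)) (Y : jet R n -> 'M[R]_(q, s)) :
  jetmx m X -> jetmx m Y -> jetmx m (fun th => X th *m Y th).
Proof.
move=> jX jY i j.
apply: (@eq_jetfun _ _ _ _ (fun th => \sum_k X th i k * Y th k j)) => [th _|].
  by rewrite mxE.
by apply: jetfun_sum => k _; exact: jetfunM.
Qed.

Lemma jetmx_tr m p q (X : jet R n -> 'M[R]_(p, q)) :
  jetmx m X -> jetmx m (fun th => (X th)^T).
Proof. by move=> jX i j; apply: eq_jetfun (jX j i) => th _; rewrite mxE. Qed.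

Lemma jetfun_det m p (X : jet R n -> 'M[R]_p) :
  jetmx m X -> jetfun U m (fun th => \det (X th)).
Proof.
move=> jX; apply: jetfun_sum => s _; apply: jetfunM; first exact: jetfun_const.
by apply: jetfun_prod => i _; exact: jX.
Qed.

(** Cramer's rule. *)
Lemma jetmx_inv m p (X : jet R n -> 'M[R]_p) :
  jetmx m X -> (forall th, U th -> X th \in unitmx) -> jetmx m (fun th => invmx (X th)).
Proof.
move=> jX uX; apply: (@eq_jetmx _ _ _ (fun th => (\det (X th))^-1 *: \adj (X th))) => [th Uth|].
  by rewrite /invmx uX.
apply: jetmxZ.
  apply: jetfunV; first exact: jetfun_det.
  by move=> th /uX; rewrite unitmxE unitfE.
move=> i j; apply: (@eq_jetfun _ _ _ _
  (fun th => (-1) ^+ (j + i) * \det (row' j (col' i (X th))))) => [th _|].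
  by rewrite mxE.
apply: jetfunM; first exact: jetfun_const.
by apply: jetfun_det => k l; apply: eq_jetfun (jX (lift j k) (lift i l)) => th _; rewrite !mxE.
Qed.

Lemma jetfun_bilin m (P : jet R n -> 'M[R]_n) (v w : jet R n -> 'rV[R]_n) :
  jetmx m P -> jetmx m v -> jetmx m w -> jetfun U m (fun th => bilin (P th) (v th) (w th)).
Proof. by move=> jP jv jw; exact: (jetmxM (jetmxM jv jP) (jetmx_tr jw)). Qed.

Lemma jetmx_velocity : jetmx 1 (@velocity R n).
Proof. by move=> i j; rewrite (ord1 i); exact: jetfun_coord. Qed.

End JetMatrices.

Section MetricJets.
Variables (R : realType) (n : nat) (U : set (jet R n)) (V : set 'rV[R]_n).
Variable (G : 'rV[R]_n -> 'M[R]_n).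
Hypothesis oU : line_open U.
Hypothesis oV : open V.
Hypothesis UV : forall th, U th -> V (th 0%N).
Hypothesis G_smooth : forall i j, smooth_on V (fun x => G x i j).
Hypothesis G_unit : forall x, V x -> G x \in unitmx.

Lemma jetfun_base h : smooth_on V h -> jetfun U 0 (fun th => h (th 0%N)).
Proof.
have trunc0 (th : jet R n) : trunc 0 th = th 0%N.
  by apply/rowP => i; rewrite mxE.
move=> sh; apply: (@eq_jetfun _ _ _ _ (fun th => h (trunc 0 th))) => [th _|].
  by rewrite trunc0.
by apply: (jetfun_lift oV sh) => th /UV; rewrite trunc0.
Qed.

Lemma jpartial_base i h (th : jet R n) :
  jpartial 0 i (fun th => h (th 0%N)) th = partial i h (th 0%N).
Proof. by rewrite jpartialE; exact: (esym (derive_line h (th 0%N) _)). Qed.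

(** Through this lemma the smoothness of the Christoffel symbols and of the
curvature reduces to that of the entries of the metric. *)
Lemma jetfun_base_partial i h : jetfun U 0 (fun th => h (th 0%N)) ->
  jetfun U 0 (fun th => partial i h (th 0%N)).
Proof.
move=> jh; apply: eq_jetfun (jetfun_partial oU 0 i jh) => th _.
exact: jpartial_base.
Qed.

Lemma jetmx_metric : jetmx U 0 (fun th => G (th 0%N)).
Proof. by move=> i j; exact: (jetfun_base (G_smooth i j)). Qed.

Lemma jetmx_inverse_metric : jetmx U 0 (fun th => invmx (G (th 0%N))).
Proof. by apply: jetmx_inv; [exact: jetmx_metric | move=> th /UV; exact: G_unit]. Qed.

Lemma jetfun_christoffel k i j : jetfun U 0 (fun th => christoffel G k i j (th 0%N)).
Proof.
apply: jetfunM; first exact: jetfun_const.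
have jG p q : jetfun U 0 (fun th => (fun y => G y p q) (th 0%N)) by exact: jetmx_metric.
apply: jetfun_sum => l _; apply: jetfunM; first exact: jetmx_inverse_metric.
by apply: jetfunB; first apply: jetfunD; exact: jetfun_base_partial (jG _ _).
Qed.

Lemma jetmx_ricci : jetmx U 0 (fun th => ricci G (th 0%N)).
Proof.
move=> j k; apply: (eq_jetfun (fun th _ => esym (mxE _ _ _ _))).
have jC p q s := @jetfun_christoffel p q s.
apply: jetfunD; apply: jetfun_sum => i _.
  by apply: jetfunB; exact: jetfun_base_partial (jC _ _ _).
by apply: jetfun_sum => p _; apply: jetfunB; apply: jetfunM.
Qed.

Lemma jetfun_scalar_curv : jetfun U 0 (fun th => scalar_curv G (th 0%N)).
Proof.
apply: jetfun_sum => j _; apply: jetfun_sum => k _.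
by apply: jetfunM; [exact: jetmx_inverse_metric | exact: jetmx_ricci].
Qed.

Definition christoffel_term (X : jet R n -> 'rV[R]_n) k (th : jet R n) : R :=
  \sum_i \sum_j christoffel G k i j (th 0%N) * th 1%N 0 i * X th 0 j.

Lemma jetfun_christoffel_term m (X : jet R n -> 'rV[R]_n) k :
  (0 < m)%N -> jetmx U m X -> jetfun U m (christoffel_term X k).
Proof.
move=> m0 jX; apply: jetfun_sum => i _; apply: jetfun_sum => j _.
apply: jetfunM (jX _ _); apply: jetfunM; last exact: jetfun_coord.
by apply: jetfun_widen (jetfun_christoffel k i j).
Qed.

Lemma accelerationE k th : acceleration G th 0 k =
  th 2%N 0 k + christoffel_term (@velocity R n) k th.
Proof. by rewrite mxE; congr (_ + _); exact: tderiv_coord. Qed.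

Lemma jetmx_acceleration : jetmx U 2 (acceleration G).
Proof.
move=> i k; rewrite (ord1 i).
apply: (eq_jetfun (fun th _ => esym (accelerationE k th))).
apply: jetfunD; first exact: jetfun_coord.
apply: (@jetfun_widen _ _ _ 1) => //.
by apply: jetfun_christoffel_term => //; exact: jetmx_velocity.
Qed.

Lemma nabla_accelerationE k th : U th -> nabla_u G (acceleration G) th 0 k =
  th 3%N 0 k + (tderiv (christoffel_term (@velocity R n) k) th +
                christoffel_term (acceleration G) k th).
Proof.
move=> Uth; rewrite mxE addrA; congr (_ + _).
rewrite (eq_tderiv oU (fun th _ => accelerationE k th) Uth) -(tderiv_coord 2 k th).
apply: (tderivD oU (m := 2)) => //; first exact: jetfun_coord.
apply: (@jetfun_widen _ _ _ 1) => //.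
by apply: jetfun_christoffel_term => //; exact: jetmx_velocity.
Qed.

End MetricJets.

Section ConformalGeodesics.
Variables (R : realType) (U : set (jet R 3)) (V : set 'rV[R]_3).
Variable (G : 'rV[R]_3 -> 'M[R]_3).
Hypothesis oU : line_open U.
Hypothesis oV : open V.
Hypothesis UV : forall th, U th -> V (th 0%N).
Hypothesis G_smooth : forall i j, smooth_on V (fun x => G x i j).
Hypothesis G_unit : forall x, V x -> G x \in unitmx.
Hypothesis U_nonnull : forall th, U th -> bilin (G (th 0%N)) (th 1%N) (th 1%N) != 0.

Lemma jetmx_schouten : jetmx U 0 (fun th => schouten G (th 0%N)).
Proof.
apply: jetmxB; first exact: (jetmx_ricci oU oV UV G_smooth G_unit).
apply: jetmxZ; last exact: (jetmx_metric oV UV G_smooth).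
by apply: jetfunM; [exact: (jetfun_scalar_curv oU oV UV G_smooth G_unit) | exact: jetfun_const].
Qed.

Lemma conformal_geodesic_solved k : exists2 r, jetfun U 2 r &
  forall th, U th -> conformal_geodesic G k th = th 3%N 0 k + r th.
Proof.
pose g (th : jet R 3) := G (th 0%N); pose P (th : jet R 3) := schouten G (th 0%N).
pose u := @velocity R 3; pose a := acceleration G.
pose rhs th : 'rV[R]_3 := (3 * bilin (g th) (u th) (a th) / bilin (g th) (u th) (u th)) *: a th
  - (3 * bilin (g th) (a th) (a th) / (2 * bilin (g th) (u th) (u th))) *: u th
  + bilin (g th) (u th) (u th) *: sharp (g th) (P th) (u th)
  - (2 * bilin (P th) (u th) (u th)) *: u th.
have jg : jetmx U 2 g by apply: (@jetmx_widen _ _ _ 0) => //; exact: (jetmx_metric oV UV G_smooth).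
have jgi : jetmx U 2 (fun th => invmx (g th)).
  by apply: (@jetmx_widen _ _ _ 0) => //; exact: (jetmx_inverse_metric oV UV G_smooth G_unit).
have jP : jetmx U 2 P by apply: (@jetmx_widen _ _ _ 0) => //; exact: jetmx_schouten.
have ju : jetmx U 2 u by apply: (@jetmx_widen _ _ _ 1) => //; exact: jetmx_velocity.
have ja : jetmx U 2 a by exact: (jetmx_acceleration oU oV UV G_smooth G_unit).
have jc c := jetfun_const U 2 (c : R).
have juu := jetfun_bilin jg ju ju.
have jrhs : jetmx U 2 rhs.
  apply: jetmxB; last by apply: jetmxZ => //; apply: jetfunM => //; exact: jetfun_bilin.
  apply: jetmxD; last by apply: jetmxZ => //; apply: jetmxM => //; exact: jetmxM.
  apply: jetmxB; apply: jetmxZ => //; apply: jetfunM.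
  - by apply: jetfunM => //; exact: jetfun_bilin.
  - by apply: jetfunV => //.
  - by apply: jetfunM => //; exact: jetfun_bilin.
  - apply: jetfunV; first exact: jetfunM.
    by move=> th Uth; rewrite mulf_neq0 ?pnatr_eq0 //; exact: U_nonnull.
exists (fun th => (tderiv (christoffel_term G u k) th + christoffel_term G a k th) - rhs th 0 k).
  apply: jetfunB => //; apply: jetfunD.
    by apply: jetfun_tderiv => //; apply: (jetfun_christoffel_term oU oV UV G_smooth G_unit) => //;
      exact: jetmx_velocity.
  exact: (jetfun_christoffel_term oU oV UV G_smooth G_unit).
move=> th Uth; rewrite addrA -(nabla_accelerationE oU oV UV G_smooth G_unit) //.
by rewrite /conformal_geodesic -/(u th) -/(a th) mxE [X in _ + X]mxE.
Qed.

End ConformalGeodesics.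

Lemma row_continuous (R : realType) p q (i : 'I_p) : continuous (@row R p q i).
Proof.
move=> A P [Q QA QP]; exists (fun k j => if k == i then Q ord0 j else setT) => [k j|B BQ].
  by case: eqP => [->|_]; [have := QA ord0 j; rewrite mxE | exact: filterT].
by apply: QP => k j; rewrite (ord1 k) mxE; have := BQ i j; rewrite eqxx.
Qed.

Lemma continuous_at_sum (R : realType) (T : topologicalType) (J : Type) (r : seq J)
    (F : J -> T -> R) x : (forall j, {for x, continuous (F j)}) ->
  {for x, continuous (fun y => \sum_(j <- r) F j y)}.
Proof.
move=> Fc; elim: r => [|j r IH].
  rewrite (_ : (fun y => _) = fun=> 0); first exact: cst_continuous.
  by apply: funext => y; rewrite big_nil.
rewrite (_ : (fun y => _) = fun y => F j y + \sum_(k <- r) F k y).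
  by apply: continuousD; [exact: Fc | exact: IH].
by apply: funext => y; rewrite big_cons.
Qed.

Section NonnullJets.
Variables (R : realType) (n : nat) (M : manifold R n) (g : pseudo_metric M) (a : cidx M).

(** Openness is needed in the space of matrices, where the Lagrangian is a
smooth function in the usual sense. *)
Lemma nonnull_open m : open [set A : 'M[R]_(m.+2, n) |
  nonnull g a (row ord0 A) (row (inord 1) A)].
Proof.
rewrite openE => A [/= Ax uu].
have Gc i j : {for A, continuous (fun B : 'M[R]_(m.+2, n) => g a (row ord0 B) i j)}.
  apply: (@continuous_comp _ _ _ (row ord0) (fun x => g a x i j)); first exact: row_continuous.
  apply: differentiable_continuous; exact: (@gram_smooth _ _ _ g a i j [::] _ Ax).
have rc k i : {for A, continuous (fun B : 'M[R]_(m.+2, n) => row k B 0 i)}.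
  have -> : (fun B : 'M[R]_(m.+2, n) => row k B 0 i) = (fun B => B k i).
    by apply: funext => B; rewrite mxE.
  exact: coord_continuous.
pose q (B : 'M[R]_(m.+2, n)) := \sum_j (\sum_i row (inord 1) B 0 i * g a (row ord0 B) i j) *
  row (inord 1) B 0 j.
have qE B : bilin (g a (row ord0 B)) (row (inord 1) B) (row (inord 1) B) = q B.
  rewrite /bilin mxE; apply: eq_bigr => j _; rewrite mxE [X in _ * X]mxE; congr (_ * _).
have qc : {for A, continuous q}.
  apply: continuous_at_sum => j; apply: continuousM; last exact: rc.
  by apply: continuous_at_sum => i; apply: continuousM; [exact: rc | exact: Gc].
have domN : nbhs A (row ord0 @^-1` ccod (charts a)).
  by apply: row_continuous; apply: open_nbhs_nbhs; split => //; exact: ccod_open.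
have qN : nbhs A (q @^-1` [set y | y != 0]).
  by apply: qc; apply: open_nbhs_nbhs; split; [exact: open_neq | rewrite /= -qE].
by apply: filterS2 domN qN => B Bx qB; split => //; rewrite qE.
Qed.

Lemma nonnull_trunc m (th : jet R n) : nonnull_jets g a th <->
  nonnull g a (row ord0 (trunc m.+1 th)) (row (inord 1) (trunc m.+1 th)).
Proof.
have -> : row ord0 (trunc m.+1 th) = th 0%N by apply/rowP => i; rewrite !mxE.
have -> // : row (inord 1) (trunc m.+1 th) = th 1%N.
by apply/rowP => i; rewrite !mxE inordK.
Qed.

Lemma line_open_nonnull_jets : line_open (nonnull_jets g a).
Proof.
move=> th j i /(nonnull_trunc 0) Uth.
have := line_open_trunc (@nonnull_open 0) j i Uth.
by apply: filterS => s ?; exact/(nonnull_trunc 0).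
Qed.

Lemma jetfun_lagrangian (L : lagrangian g) :
  jetfun (nonnull_jets g a) (lag_ord L).+1 (lag_jet L a).
Proof.
apply: (jetfun_lift (@nonnull_open _) (@lag_smooth _ _ _ _ L a)) => th.
by move=> /(nonnull_trunc (lag_ord L)).
Qed.

End NonnullJets.

(** Polarization: a symmetric matrix with no non-null vector is zero. *)
Lemma symmetric_nonnull (R : numFieldType) n (A : 'M[R]_n.+1) :
  A^T = A -> A \in unitmx -> exists u : 'rV[R]_n.+1, (u *m A *m u^T) 0 0 != 0.
Proof.
move=> symA uA; apply: contrapT => /forallNP null.
have q0 (u : 'rV[R]_n.+1) : (u *m A *m u^T) 0 0 = 0 by have /negP := null u; rewrite negbK => /eqP.
suff A0 : A = 0 by move: uA; rewrite A0 unitmxE det0 unitr0.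
apply/matrixP => i j; rewrite mxE.
have entry k l : ((delta_mx 0 k : 'rV[R]_n.+1) *m A *m (delta_mx 0 l : 'rV[R]_n.+1)^T) 0 0 = A k l.
  by rewrite -rowE trmx_delta -colE !mxE.
have := q0 (delta_mx 0 i + delta_mx 0 j).
rewrite [(_ + _)^T]linearD mulmxDl mulmxDl !mulmxDr.
rewrite mxE [X in X + _]mxE [X in _ + X]mxE !q0 !entry add0r addr0.
have -> : A j i = A i j by rewrite -{1}symA mxE.
by move/eqP; rewrite -mulr2n mulrn_eq0 => /eqP.
Qed.

(** In a chart the equation is a system of three equations of order three, so
its solution space has the odd dimension nine. *)
Theorem proposition2 (R : realType) (M : manifold R 3) (g : pseudo_metric M)
    (M_nonempty : [set: M] !=set0) :
  ~ variational g (fun a => conformal_geodesic (g a)).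
Proof.
move=> [L EL]; have [p _] := M_nonempty; have [a ap] := charts_cover p.
have x_cod := cmap_cod ap; set x := cmap (charts a) p in x_cod.
have [u uu] := symmetric_nonnull (gram_sym g x_cod) (gram_unit g x_cod).
have oU := @line_open_nonnull_jets R 3 M g a.
have /choice[r rP] : forall k, exists r, jetfun (nonnull_jets g a) 2 r /\ forall th,
    nonnull_jets g a th -> conformal_geodesic (g a) k th = th 3%N 0 k + r th.
  move=> k; have [r jr rE] := conformal_geodesic_solved oU (@ccod_open _ _ _ (charts a))
    (fun th => @proj1 _ _) (@gram_smooth _ _ _ g a) (@gram_unit _ _ _ g a)
    (fun th => @proj2 _ _) k.
  by exists r.
apply: (@odd_order_not_variational R 3 (nonnull_jets g a) 2 r
  (conformal_geodesic (g a)) _ (lag_jet L a) oU _ _ _ _ isT (jetfun_lagrangian a L)).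
- by exists (fun j => if j is 0%N then x else u).
- by move=> th th' E; rewrite /nonnull_jets /= (E 0%N) // (E 1%N).
- by move=> k; exact: (rP k).1.
- by move=> th k; exact: (rP k).2.
- exact: EL.
Qed.
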